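(* Let $(R,m)$ be a complete discrete valuation ring containing a field $k$ of characteristic $0$, and let $B$ denote the integral closure of $R$ in an algebraic extension $F$ of the field of fractions $Q(R)$. Then $\mathrm{Hom}_R(\Omega_{B/k},R)\neq 0$.
   Context: $\Omega_{B/k}$ denotes the module of Kähler differentials of $B$ over $k$ (not completed). The algebraic extension $F/Q(R)$ may be infinite. *)

(* Defs.v *)
From HB Require Import structures.
From mathcomp Require Import all_boot all_order all_algebra.
From mathcomp Require Import boolp.
From mathcomp Require Import freeg.

Set Implicit Arguments.
Unset Strict Implicit.
Unset Printing Implicit Defensive.

Import GRing.Theory.

Local Open Scope ring_scope.
Local Open Scope quotient_scope.

(* Ideals are [{pred R}]; [idealr_closed], from ring_quotient, is the notion of
   a proper ideal. *)
Definition is_ideal (R : comNzRingType) (I : {pred R}) : Prop :=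
  0 \in I /\ forall a, {in I &, forall u v, a * u + v \in I}.

Definition is_principal (R : comNzRingType) (I : {pred R}) : Prop :=
  exists a, forall x, x \in I <-> exists b, x = b * a.

Definition is_maximal_ideal (R : comNzRingType) (m : {pred R}) : Prop :=
  idealr_closed m /\
  forall J : {pred R}, idealr_closed J -> {subset m <= J} -> {subset J <= m}.

(* A discrete valuation ring is a local principal ideal domain that is not a
   field, i.e. whose maximal ideal is nonzero. *)
Definition is_dvr (R : idomainType) (m : {pred R}) : Prop :=
  [/\ forall I : {pred R}, is_ideal I -> is_principal I,
      is_maximal_ideal m,
      forall m' : {pred R}, is_maximal_ideal m' -> m' =i m
    & exists2 x, x \in m & x != 0].

Definition ideal_mul (R : comNzRingType) (I J : {pred R}) : {pred R} :=
  fun x => `[< exists s : seq (R * R),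
    {in s, forall p, p.1 \in I /\ p.2 \in J} /\ x = \sum_(p <- s) p.1 * p.2 >].

Fixpoint ideal_exp (R : comNzRingType) (I : {pred R}) (n : nat) : {pred R} :=
  if n is n'.+1 then ideal_mul I (ideal_exp I n') else predT.

(* Bijectivity of R -> lim_n R/I^n: [u] lifts a compatible family of residues;
   existence of [l] is surjectivity, uniqueness is separatedness. *)
Definition adically_complete (R : comNzRingType) (I : {pred R}) : Prop :=
  forall u : nat -> R, (forall n, u n.+1 - u n \in ideal_exp I n) ->
  exists! l, forall n, u n - l \in ideal_exp I n.

Section IntegralClosure.
Variables (R : comNzRingType) (F : fieldType) (f : {rmorphism R -> F}).

Definition integral_pred : {pred F} := fun x => `[< integralOver f x >].

Fact integral_pred_subring : subring_closed integral_pred.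
Proof.
split=> [|x y /asboolP fx /asboolP fy|x y /asboolP fx /asboolP fy];
  apply/asboolP.
- exact: integral1.
- exact: integral_sub.
- exact: integral_mul.
Qed.

HB.instance Definition _ :=
  GRing.isSubringClosed.Build F integral_pred integral_pred_subring.

Record intClosure : Type := IntClosure {
  intClosure_val : F;
  _ : intClosure_val \in integral_pred
}.

HB.instance Definition _ := [isSub for intClosure_val].
HB.instance Definition _ := [Choice of intClosure by <:].
HB.instance Definition _ := [SubChoice_isSubComNzRing of intClosure by <:].

Fact toIntClosure_subproof x : f x \in integral_pred.
Proof. exact/asboolP/integral_id. Qed.

Definition toIntClosure (x : R) : intClosure :=
  IntClosure (toIntClosure_subproof x).

Fact toIntClosure_is_zmod_morphism : zmod_morphism toIntClosure.
Proof. by move=> x y; apply: val_inj; rewrite rmorphB /= rmorphB. Qed.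

Fact toIntClosure_is_monoid_morphism : monoid_morphism toIntClosure.
Proof.
by split=> [|x y]; apply: val_inj; rewrite /= ?rmorphM ?rmorph1 ?rmorphM.
Qed.

HB.instance Definition _ := GRing.isZmodMorphism.Build R intClosure
  toIntClosure toIntClosure_is_zmod_morphism.
HB.instance Definition _ := GRing.isMonoidMorphism.Build R intClosure
  toIntClosure toIntClosure_is_monoid_morphism.

End IntegralClosure.

Section FreegLift.
Variables (B : comNzRingType) (K : choiceType) (M : lmodType B) (f : K -> M).

HB.instance Definition _ := GRing.isZmodMorphism.Build {freeg K / B} M
  (fglift f) (lift_is_additive f).

Lemma freegZ (a c : B) (x : K) :
  a *: << c *g x >> = << a * c *g x >> :> {freeg K / B}.
Proof. by apply/eqP/freeg_eqP => y; rewrite coeffZ !coeffU mulrA. Qed.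

Fact fglift_is_scalable : scalable (fglift f).
Proof.
move=> a u; rewrite -[u]freeg_sumE scaler_sumr !raddf_sum /=.
by apply: eq_bigr => b _; rewrite /= freegZ !liftU scalerA.
Qed.

HB.instance Definition _ := GRing.isScalable.Build B {freeg K / B} M *:%R
  (fglift f) fglift_is_scalable.

End FreegLift.

(* The Kaehler differentials of B over k: the free B-module on the symbols db
   ([<< b >>] in [{freeg B / B}]), b in B, modulo the B-submodule generated by
   the sum rule, the Leibniz rule and d(phi c) = 0. *)
Section Kaehler.
Variables (k B : comNzRingType) (phi : {rmorphism k -> B}).

Notation symb b := (<< b >> : {freeg B / B}).

Variant kaehler_relator : {freeg B / B} -> Prop :=
| KaehlerAdd a b : kaehler_relator (symb (a + b) - symb a - symb b)
| KaehlerMul a b : kaehler_relator (symb (a * b) - a *: symb b - b *: symb a)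
| KaehlerCst c : kaehler_relator (symb (phi c)).

Definition kaehler_relations : {pred {freeg B / B}} := fun w =>
  `[< forall S : {pred {freeg B / B}}, submod_closed S ->
        (forall r, kaehler_relator r -> r \in S) -> w \in S >].

Fact kaehler_relations_submod : submod_closed kaehler_relations.
Proof.
split=> [|a u v /asboolP Ru /asboolP Rv]; apply/asboolP => S clS relS.
  by case: clS.
by case: (clS) => _; apply; [apply: Ru | apply: Rv].
Qed.

HB.instance Definition _ :=
  GRing.isSubmodClosed.Build B {freeg B / B} kaehler_relations
    kaehler_relations_submod.

Definition kaehler : Type := Quotient.quot kaehler_relations.

HB.instance Definition _ := Choice.on kaehler.
HB.instance Definition _ := Quotient.on kaehler.
HB.instance Definition _ := GRing.Zmodule.on kaehler.

Definition kaehler_pi (w : {freeg B / B}) : kaehler := \pi_kaehler w.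

Fact kaehler_piP u v : kaehler_pi u = kaehler_pi v <-> u - v \in kaehler_relations.
Proof.
rewrite /kaehler_pi -Quotient.equivE; split=> [/eqmodP //|uv]; exact/eqmodP.
Qed.

Fact kaehler_piK (w : kaehler) : kaehler_pi (repr w) = w.
Proof. exact: reprK. Qed.

Fact kaehler_pi_is_zmod_morphism : zmod_morphism kaehler_pi.
Proof. exact: (@pi_is_zmod_morphism _ _ _ (Quotient.quot kaehler_relations)). Qed.

HB.instance Definition _ := GRing.isZmodMorphism.Build {freeg B / B} kaehler
  kaehler_pi kaehler_pi_is_zmod_morphism.

Definition kaehler_scale (a : B) (w : kaehler) : kaehler :=
  kaehler_pi (a *: repr w).

Fact kaehler_scale_pi a u : kaehler_scale a (kaehler_pi u) = kaehler_pi (a *: u).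
Proof.
by apply/kaehler_piP; rewrite -scalerBr rpredZ //; apply/kaehler_piP/kaehler_piK.
Qed.

Fact kaehler_scaleA a b w :
  kaehler_scale a (kaehler_scale b w) = kaehler_scale (a * b) w.
Proof. by rewrite -[w]kaehler_piK !kaehler_scale_pi scalerA. Qed.

Fact kaehler_scale1 : left_id 1 kaehler_scale.
Proof. by move=> w; rewrite -[w]kaehler_piK kaehler_scale_pi scale1r. Qed.

Fact kaehler_scaleDr : right_distributive kaehler_scale +%R.
Proof.
move=> a v w; rewrite -[v]kaehler_piK -[w]kaehler_piK.
by rewrite -raddfD !kaehler_scale_pi scalerDr raddfD.
Qed.

Fact kaehler_scaleDl w : {morph kaehler_scale^~ w : a b / a + b}.
Proof.
by move=> a b; rewrite -[w]kaehler_piK !kaehler_scale_pi scalerDl raddfD.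
Qed.

HB.instance Definition _ := GRing.Zmodule_isLmodule.Build B kaehler
  kaehler_scaleA kaehler_scale1 kaehler_scaleDr kaehler_scaleDl.

Fact kaehler_pi_is_scalable : scalable kaehler_pi.
Proof. by move=> a u; rewrite -kaehler_scale_pi. Qed.

HB.instance Definition _ := GRing.isScalable.Build B {freeg B / B} kaehler
  *:%R kaehler_pi kaehler_pi_is_scalable.

Definition kaehler_d (b : B) : kaehler := kaehler_pi (symb b).

Definition is_derivation (M : lmodType B) (D : B -> M) : Prop :=
  [/\ forall a b, D (a + b) = D a + D b,
      forall a b, D (a * b) = a *: D b + b *: D a
    & forall c, D (phi c) = 0].

Lemma kaehler_relatorP r : kaehler_relator r -> kaehler_pi r = 0.
Proof.
move=> relr; rewrite -(raddf0 kaehler_pi); apply/kaehler_piP; rewrite subr0.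
by apply/asboolP => S _; apply.
Qed.

Lemma kaehler_d_derivation : is_derivation kaehler_d.
Proof.
split=> [a b|a b|c]; last exact/kaehler_relatorP/KaehlerCst.
  have /kaehler_relatorP := KaehlerAdd a b; rewrite !raddfB /= => /eqP.
  by rewrite -addrA -opprD subr_eq0 => /eqP.
have /kaehler_relatorP := KaehlerMul a b; rewrite !raddfB /= => /eqP.
by rewrite -addrA -opprD subr_eq0 -!kaehler_scale_pi => /eqP.
Qed.

Lemma kaehler_universal (M : lmodType B) (D : B -> M) : is_derivation D ->
  exists2 g : {linear kaehler -> M}, (forall b, g (kaehler_d b) = D b)
  & forall h : {linear kaehler -> M}, (forall b, h (kaehler_d b) = D b) -> h =1 g.
Proof.
case=> DD DM Dc.
have lift1 b : fglift D (symb b) = D b by rewrite liftU scale1r.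
have lift_rel u : u \in kaehler_relations -> fglift D u = 0.
  move/asboolP/(_ (fun v => fglift D v == 0)) => Ru; apply/eqP; apply: Ru.
    split=> [|a v w]; first by rewrite unfold_in linear0.
    rewrite !unfold_in => /eqP v0 /eqP w0.
    by rewrite linearP /= v0 w0 scaler0 addr0.
  move=> _ [a b|a b|c]; rewrite unfold_in /=; do ?rewrite linearB /=;
    do ?rewrite linearZ /=; rewrite !lift1.
  - by rewrite DD -addrA -opprD subrr.
  - by rewrite DM -addrA !scalerN -opprD subrr.
  - by rewrite Dc.
pose g (w : kaehler) := fglift D (repr w).
have gpi u : g (kaehler_pi u) = fglift D u.
  apply/eqP; rewrite -subr_eq0 -linearB; apply/eqP/lift_rel.
  exact/kaehler_piP/kaehler_piK.
have g_lin : linear g.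
  move=> a v w; rewrite -[v]kaehler_piK -[w]kaehler_piK.
  by rewrite -linearP !gpi linearP.
pose gL : {linear kaehler -> M} :=
  HB.pack g (GRing.isLinear.Build B kaehler M *:%R g g_lin).
exists gL => [b|h hd w]; first by rewrite /= gpi lift1.
rewrite -[w]kaehler_piK -[repr w]freeg_sumE !raddf_sum /=.
apply: eq_bigr => b _; rewrite gpi liftU -hd -linearZ /=; congr (h _).
by rewrite -linearZ freegZ mulr1.
Qed.

End Kaehler.

(* M seen as an A-module through f. *)
Definition restrict_scalars (A B : nzRingType) (f : {rmorphism A -> B})
  (M : lmodType B) : Type := M.
Arguments restrict_scalars {A B} f M.

Section RestrictScalars.
Variables (A B : nzRingType) (f : {rmorphism A -> B}) (M : lmodType B).

Local Notation MA := (restrict_scalars f M).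

HB.instance Definition _ := GRing.Zmodule.on MA.

Let scale (a : A) (x : MA) : MA := f a *: (x : M).

Fact restrict_scalarsA a b x : scale a (scale b x) = scale (a * b) x.
Proof. by rewrite /scale scalerA rmorphM. Qed.

Fact restrict_scalars1 : left_id 1 scale.
Proof. by move=> x; rewrite /scale rmorph1 scale1r. Qed.

Fact restrict_scalarsDr : right_distributive scale +%R.
Proof. by move=> a x y; rewrite /scale scalerDr. Qed.

Fact restrict_scalarsDl x : {morph scale^~ x : a b / a + b}.
Proof. by move=> a b; rewrite /scale rmorphD scalerDl. Qed.

HB.instance Definition _ := GRing.Zmodule_isLmodule.Build A MA
  restrict_scalarsA restrict_scalars1 restrict_scalarsDr restrict_scalarsDl.

End RestrictScalars.

(* Main.v *)
Require Import Defs.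
From HB Require Import structures.
From mathcomp Require Import all_boot all_order all_algebra.
From mathcomp Require Import boolp classical_sets ring.
From mathcomp Require Import fraction separable freeg.
Import GRing.Theory.
Local Open Scope ring_scope.

Set Implicit Arguments.
Unset Strict Implicit.
Unset Printing Implicit Defensive.

(** Let t be a uniformizer of R, Q the fraction field and B the integral
    closure of R in F. A derivation D of F over k which maps B into an
    R-submodule V of F that contains B and is stable under multiplication by
    B induces a B-linear map from the differentials of B to V. If there is
    also an R-linear map g from V to R, the composite is an R-linear form on
    the differentials, and it sends db to g (D b). So it is enough to find
    D, V and g with D t = t and g the identity on R: the form then sends dt
    to t.

    The derivation. In characteristic 0 the ring R contains a coefficient
    field K that contains the image of k (coefficient_field_exists, from
    Hensel's lemma), so R is K[[t]] and d = t d/dt is a derivation of R over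
    k (log_derivation_exists). As F is algebraic over Q in characteristic 0,
    it extends to F (fraction_derivation, algebraic_derivation).

    The module. V is a valuation ring of F that contains R but not 1/t
    (valuation_ring_exists); it is integrally closed, hence contains B. The
    main point is that D maps V to itself (valuation_ring_der_stable). This
    uses t d/dt and not d/dt, which takes the square root of t to half its
    inverse. Let x be in V. By separability of the residue extension there
    is p over K with y = p(x) in the maximal ideal and p'(x) a unit, and D y
    = p'(x) D x. Some power of y is w q with w a unit of V and q in Q, and
    the logarithmic derivative of q is in V. So D x is, up to elements of V,
    a multiple of y D w (der_step): if D takes w outside V, then it takes x
    less far outside V than w. All these elements stay in the finite
    extension Q[u] generated by the initial x = u. There the value of y is
    at least a fixed positive fraction of that of t (max_power_divisible),
    while the denominators of D are bounded (der_bounded). This leaves no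
    room for denominators.

    The retraction. Let W be a maximal R-submodule of F that contains V and
    meets Q only in R. Then W + Q = F, and for x in V there is a unique r in
    R such that x - r is infinitely divisible by t in W, by completeness of
    R (retraction_exists). The retraction is also used for the bound on D:
    the bilinear form g (x y) is nondegenerate on Q[u], so an element of V
    in Q[u] is recovered from its products with the powers of u with a fixed
    denominator (gram_bound). *)

(** * Maximal closed sets and complete discrete valuation rings *)

Definition closed_under (I T : Type) (op : I -> T -> T -> T) (A : T -> Prop) :=
  forall i x y, A x -> A y -> A (op i x y).

(** Zorn's lemma, in a form suited to subrings and submodules: the operations
    are binary, so two elements of the union of a chain already lie in one
    member of the chain and the union stays closed. It produces the
    coefficient field, the valuation ring and the submodule behind the
    retraction. *)
Lemma maximal_closed_avoiding (I T : Type) (op : I -> T -> T -> T)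
    (A0 Z : T -> Prop) :
  closed_under op A0 -> (forall x, A0 x -> ~ Z x) ->
  exists A : T -> Prop,
    [/\ closed_under op A, forall x, A0 x -> A x, forall x, A x -> ~ Z x
      & forall B : T -> Prop, closed_under op B -> (forall x, A x -> B x) ->
          (forall x, B x -> ~ Z x) -> forall x, B x -> A x].
Proof.
move=> clA0 A0Z.
pose P (A : set T) := closed_under op (fun x => A x \/ A0 x) /\
  forall x, A x -> ~ Z x.
have [|A [[clA AZ] maxA]] := @Zorn_bigcup T P.
  move=> C CP totC; split=> [i x y|x [X CX Xx]]; last exact: (CP X CX).2.
  have inU X : C X -> X x \/ A0 x -> X y \/ A0 y ->
      (\bigcup_(Y in C) Y)%classic (op i x y) \/ A0 (op i x y).
    move=> CX Xx Xy; have [Xo|A0o] := (CP X CX).1 i x y Xx Xy; last by right.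
    by left; exists X.
  case=> [[X CX Xx]|A0x]; case=> [[Y CY Yy]|A0y].
  - have [XY|YX] := totC X Y CX CY.
      by apply: (inU Y) => //; left => //; apply: XY.
    by apply: (inU X) => //; left => //; apply: YX.
  - by apply: (inU X) => //; [left | right].
  - by apply: (inU Y) => //; [right | left].
  - by right; apply: clA0.
exists (fun x => A x \/ A0 x);
  split=> // [x|x [/AZ //|/A0Z //]|B clB AB BZ x Bx].
  by right.
apply: contrapT => nAx; apply: (maxA B).
  by split=> [y Ay|BA]; [apply: AB; left | apply: nAx; left; apply: BA].
split=> // i y z [By|A0y] [Bz|A0z]; left; apply: clB => //; apply: AB; by right.
Qed.

Section CompleteDvr.
Variables (R : idomainType) (t : R).

Definition tdvd n (x : R) := exists y, x = y * t ^+ n.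

(** Completeness asks for limits only; their uniqueness is tdvd_separated. The
    clause unit_or_tdvd says that the ring is local with maximal ideal
    generated by t. *)
Record complete_dvr : Prop := CompleteDvr {
  unif_neq0 : t != 0;
  unif_nonunit : t \isn't a GRing.unit;
  unit_or_tdvd : forall x, x \is a GRing.unit \/ tdvd 1 x;
  tdvd_separated : forall x, (forall n, tdvd n x) -> x = 0;
  tdvd_complete : forall u : nat -> R, (forall n, tdvd n (u n.+1 - u n)) ->
    exists l, forall n, tdvd n (u n - l)
}.

Lemma tdvd0 n : tdvd n 0. Proof. by exists 0; rewrite mul0r. Qed.

Lemma tdvd_lin n a x y : tdvd n x -> tdvd n y -> tdvd n (a * x + y).
Proof. by case=> b -> [c ->]; exists (a * b + c); ring. Qed.

Lemma tdvdD n x y : tdvd n x -> tdvd n y -> tdvd n (x + y).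
Proof. by move=> /(tdvd_lin 1); rewrite mul1r => h /h. Qed.

Lemma tdvdMl n a x : tdvd n x -> tdvd n (a * x).
Proof. by case=> b ->; exists (a * b); rewrite mulrA. Qed.

Lemma tdvdN n x : tdvd n x -> tdvd n (- x).
Proof. by rewrite -mulN1r; apply: tdvdMl. Qed.

Lemma tdvdB n x y : tdvd n x -> tdvd n y -> tdvd n (x - y).
Proof. by move=> xn /tdvdN; apply: tdvdD. Qed.

Lemma tdvdM n m x y : tdvd n x -> tdvd m y -> tdvd (n + m) (x * y).
Proof. by case=> a -> [b ->]; exists (a * b); rewrite exprD; ring. Qed.

Lemma tdvd_leq n m x : (m <= n)%N -> tdvd n x -> tdvd m x.
Proof.
by move=> mn [y ->]; exists (y * t ^+ (n - m)); rewrite -mulrA -exprD subnK.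
Qed.

Lemma tdvdX n : tdvd n (t ^+ n).
Proof. by exists 1; rewrite mul1r. Qed.

Lemma tdvd_unif : tdvd 1 t.
Proof. exact: (tdvdX 1). Qed.

Lemma tdvd_ind (x y : R) n : tdvd n (x - y) -> tdvd n y -> tdvd n x.
Proof. by move=> xy yn; rewrite -(subrK y x); apply: tdvdD. Qed.

Hypothesis dvrR : complete_dvr.

Lemma tdvdSX n x : tdvd n.+1 (x * t) -> tdvd n x.
Proof.
case=> y xy; exists y; apply: (mulIf (unif_neq0 dvrR)).
by rewrite xy exprSr mulrA.
Qed.

Lemma tdvd1_nonunit x : tdvd 1 x -> x \isn't a GRing.unit.
Proof.
by case=> y ->; rewrite expr1 unitrM (negPf (unif_nonunit dvrR)) andbF.
Qed.

Lemma unit_unif_decomp x : x != 0 ->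
  exists n u, u \is a GRing.unit /\ x = u * t ^+ n.
Proof.
move=> x0; have [n nx] : exists n, ~ tdvd n x.
  apply: contrapT => h; move/eqP: x0; apply; apply: (tdvd_separated dvrR) => n.
  by apply: contrapT => nx; apply: h; exists n.
elim: n x x0 nx => [|n IH] x x0 nx; first by case: nx; exists x; rewrite mulr1.
case: (unit_or_tdvd dvrR x) => [ux|[y xy]]; first by exists 0%N, x;
  rewrite mulr1.
have [||k [u [uu yu]]] := IH y.
- by apply: contraNneq x0 => y0; rewrite xy y0 mul0r.
- by case=> z yz; case: nx; exists z; rewrite xy yz expr1 exprSr mulrA.
by exists k.+1, u; rewrite xy yu expr1 exprSr mulrA.
Qed.

End CompleteDvr.

Section FromIdeals.
Variables (R : idomainType) (m : {pred R}).

Lemma ideal_exp_principal t : (forall x, x \in m <-> exists b, x = b * t) ->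
  forall n x, x \in ideal_exp m n <-> tdvd t n x.
Proof.
move=> mt; elim=> [|n IH] x; first by split=> // _; exists x; rewrite mulr1.
split=> [/asboolP[s [ms ->]]|[y ->]].
  rewrite big_seq; apply: (big_ind (tdvd t n.+1)) => [||p /ms[/mt p1 /IH p2]].
  - exact: tdvd0.
  - exact: tdvdD.
  - by rewrite -add1n; apply: tdvdM => //; case: p1 => b ->; exists b.
apply/asboolP; exists [:: (t, y * t ^+ n)]; split; last first.
  by rewrite big_seq1 /= exprS; ring.
move=> p; rewrite inE => /eqP -> /=; split; last by apply/IH; exists y.
by apply/mt; exists 1; rewrite mul1r.
Qed.

Lemma complete_dvr_of_ideals : is_dvr m -> adically_complete m ->
  exists t : R, complete_dvr t.
Proof.
case=> pid [clm maxm] _ [x0 mx0 x0n0] compl.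
have [m0 [m1 mlin]] := clm.
have [t mt] : is_principal m.
  by apply: pid; split=> [|a u v]; [exact: m0 | exact: mlin].
have dvdE := ideal_exp_principal mt.
have tm : t \in m by apply/mt; exists 1; rewrite mul1r.
have sep x : (forall n, tdvd t n x) -> x = 0.
  move=> xn; have [|l [_ ul]] := compl (fun=> 0).
    by move=> n; rewrite subr0; apply/dvdE/tdvd0.
  transitivity l; last symmetry; last first.
    symmetry; apply: ul => n; rewrite subr0; apply/dvdE/tdvd0.
  symmetry; apply: ul => n; rewrite sub0r; apply/dvdE/tdvdN/xn.
have lim u : (forall n, tdvd t n (u n.+1 - u n)) ->
    exists l, forall n, tdvd t n (u n - l).
  move=> un; have [|l [ul _]] := compl u; first by move=> n; apply/dvdE.
  by exists l => n; apply/dvdE.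
exists t; split=> //.
- apply: contraNneq x0n0 => t0; have [b ->] := (mt x0).1 mx0.
  by rewrite t0 mulr0.
- apply: contra m1 => ut; apply/mt; exists t^-1; exact/esym/mulVr.
(* By maximality, an x outside m satisfies 1 = a x + y with y in m, and the
   geometric series inverts 1 - y = a x. *)
move=> x; have [mx|mx] := boolP (x \in m).
  by right; have [b ->] := (mt x).1 mx; exists b; rewrite expr1.
left.
pose J : {pred R} := fun z => `[< exists a y, y \in m /\ z = a * x + y >].
have [a [y [my xy]]] : exists a y, y \in m /\ 1 = a * x + y.
  apply: contrapT => J1; move/negP: mx; apply; apply: (maxm J).
  - split.
    - by apply/asboolP; exists 0, 0; split=> //; rewrite mul0r addr0.
    - by apply: contra_notN J1 => /asboolP.
    - move=> b _ _ /asboolP[a [y [my ->]]] /asboolP[a' [y' [my' ->]]].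
      apply/asboolP; exists (b * a + a'), (b * y + y').
      by split; [exact: mlin | ring].
  - by move=> y my; apply/asboolP; exists 0, y; rewrite mul0r add0r.
  - by apply/asboolP; exists 1, 0; split=> //; rewrite mul1r addr0.
have ty n : tdvd t n (y ^+ n).
  by have [b ->] := (mt y).1 my; exists (b ^+ n); rewrite exprMn.
have [|l ul] := lim (fun n => \sum_(i < n) y ^+ i).
  by move=> n; rewrite big_ord_recr /= addrAC subrr add0r.
suff l1 : l * (1 - y) = 1.
  by apply/unitrPr; exists (l * a); rewrite -[RHS]l1 xy; ring.
apply/eqP; rewrite -subr_eq0; apply/eqP/sep => n.
have -> : l * (1 - y) - 1 =
    (y - 1) * (\sum_(i < n) y ^+ i - l) - y ^+ n.
  by rewrite [(y - 1) * _]mulrBr -subrX1; ring.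
by apply: tdvdB => //; apply: tdvdMl.
Qed.

End FromIdeals.

(** * Coefficient fields *)

Lemma ex_minimal_size (R : nzRingType) (P : {poly R} -> Prop) (p0 : {poly R}) :
  P p0 -> exists2 p, P p & forall q, P q -> (size p <= size q)%N.
Proof.
move=> Pp0; have exn : exists n, `[< exists2 p, P p & size p = n >].
  by exists (size p0); apply/asboolP; exists p0.
case: (ex_minnP exn) => n /asboolP[p Pp <-] minp; exists p => // q Pq.
by apply: minp; apply/asboolP; exists q.
Qed.

(** Subtraction and multiplication as a single family of operations: a subring
    is then a set that contains 1 and is closed under that family. *)
Definition subring_op (A : pzRingType) (b : bool) (x y : A) :=
  if b then x * y else x - y.

Lemma horner_values_closed (A : comNzRingType) (S : subringClosed A) z :
  closed_under (@subring_op A)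
    (fun x => exists2 p, p \is a polyOver S & x = p.[z]).
Proof.
move=> [] _ _ [p Sp ->] [q Sq ->] /=.
  by exists (p * q); rewrite ?hornerM ?rpredM.
by exists (p - q); rewrite ?hornerE ?rpredB.
Qed.

Lemma horner_taylor1 (R : comNzRingType) (p : {poly R}) a h :
  exists s, p.[a + h] = p.[a] + p^`().[a] * h + s * h ^+ 2.
Proof.
elim/poly_ind: p => [|p c [s ps]].
  by exists 0; rewrite deriv0 !horner0; ring.
exists (p^`().[a] + s * (a + h)).
by rewrite derivD derivM derivX derivC !(hornerD, hornerM, hornerX, hornerC)
  ps; ring.
Qed.

Lemma deriv_neq0 (R : idomainType) (p : {poly R}) :
  (forall n, n.+1%:R != 0 :> R) -> (1 < size p)%N -> p^`() != 0.
Proof.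
move=> nat0 szp; apply/eqP => /polyP/(_ (size p).-2)/eqP.
rewrite coef_deriv coef0 -mulr_natr.
have p0 : p != 0 by rewrite -size_poly_gt0 ltnW.
case: (size p) szp (lead_coefE p) => [|[|n]] //= _ <-.
by rewrite mulf_eq0 lead_coef_eq0 (negPf p0) (negPf (nat0 n)).
Qed.

Section Hensel.
Variables (R : idomainType) (t : R).
Hypothesis dvrR : complete_dvr t.

Lemma tdvd_horner n (p : {poly R}) a b :
  tdvd t n (a - b) -> tdvd t n (p.[a] - p.[b]).
Proof.
move=> ab; elim/poly_ind: p => [|p c IH]; first by rewrite !horner0;
  apply: tdvdB; apply: tdvd0.
rewrite !hornerE.
have -> : p.[a] * a + c - (p.[b] * b + c) =
  a * (p.[a] - p.[b]) + p.[b] * (a - b).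
  by ring.
by apply: tdvdD; apply: tdvdMl.
Qed.

(** Newton's iteration with the slope fixed at p'(x): the values of p gain one
    power of t at each step, which suffices for convergence and avoids
    inverting a new slope each time. *)
Lemma hensel (p : {poly R}) x :
  tdvd t 1 p.[x] -> p^`().[x] \is a GRing.unit ->
  exists2 z, p.[z] = 0 & tdvd t 1 (z - x).
Proof.
move=> px ud; set d := p^`().[x] in ud *.
pose u n := iter n (fun z => z - p.[z] / d) x.
have uS n : u n.+1 = u n - p.[u n] / d by [].
have inv n : tdvd t 1 (u n - x) /\ tdvd t n.+1 p.[u n].
  elim: n => [|n [ux pu]]; first by rewrite /= subrr; split=> //; apply: tdvd0.
  split.
    have -> : u n.+1 - x = u n - x - d^-1 * p.[u n] by rewrite uS; ring.
    by apply: tdvdB => //; apply: tdvdMl; apply: tdvd_leq pu.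
  rewrite uS; have [s ->] := horner_taylor1 p (u n) (- (p.[u n] / d)).
  have -> : p.[u n] + p^`().[u n] * - (p.[u n] / d) + s * (- (p.[u n] / d)) ^+ 2
    = - d^-1 * (p^`().[u n] - d) * p.[u n]
      + s * d^-1 ^+ 2 * (p.[u n] * p.[u n]).
    by rewrite -{1}(mulKr ud p.[u n]); ring.
  apply: tdvdD.
    rewrite -add1n; apply: tdvdM => //; apply: tdvdMl; exact: tdvd_horner.
  apply: tdvdMl; apply: (@tdvd_leq _ _ (n.+1 + n.+1)); last exact: tdvdM.
  by rewrite addSn ltnS leq_addl.
have [|z uz] := tdvd_complete dvrR (u := u).
  move=> n; rewrite uS addrAC subrr add0r mulrC -mulNr; apply: tdvdMl.
  exact: tdvd_leq (inv n).2.
exists z.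
  apply: (tdvd_separated dvrR) => n.
  apply: (tdvd_ind (y := p.[u n])); last exact: tdvd_leq (inv n).2.
  by rewrite -opprB; apply: tdvdN; apply: tdvd_horner.
have -> : z - x = (u 1%N - x) - (u 1%N - z) by ring.
by apply: tdvdB => //; exact: (inv 1%N).1.
Qed.

End Hensel.

Section CoefficientField.
Variables (R : idomainType) (t : R) (k : fieldType) (i : {rmorphism k -> R}).
Hypotheses (dvrR : complete_dvr t) (chk : [pchar k] =i pred0).

Lemma natr_unit n : (n.+1)%:R \is a @GRing.unit R.
Proof.
rewrite -(rmorph_nat i) rmorph_unit // unitfE.
by move/pcharf0P: chk => ->.
Qed.

(** A subring that meets the ideal of t only in 0 and contains a
    representative of each residue class; it is a field, since a nonzero c in
    K has an inverse whose representative c' satisfies c c' = 1 in K. *)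
Record coefficient_field (K : {pred R}) : Prop := CoefficientField {
  coef_field_img : forall c, i c \in K;
  coef_field_tdvd : forall c, c \in K -> tdvd t 1 c -> c = 0;
  coef_field_repr : forall x, exists2 c, c \in K & tdvd t 1 (x - c)
}.

(* Here K is maximal among the subrings that contain the image of k and meet
   the ideal of t only in 0: whatever can be adjoined to K without spoiling
   this is in K. *)
Section Maximal.
Variable K : subringClosed R.
Hypothesis Ki : forall c, i c \in K.
Hypothesis Kt : forall c, c \in K -> tdvd t 1 c -> c = 0.
Hypothesis Kmax : forall z,
  (forall p, p \is a polyOver K -> tdvd t 1 p.[z] -> p.[z] = 0) -> z \in K.

Let K_unit c : c \in K -> c != 0 -> c \is a GRing.unit.
Proof.
move=> Kc c0; case: (unit_or_tdvd dvrR c) => // /(Kt Kc)/eqP.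
by rewrite (negPf c0).
Qed.

(* If a value p(1/c) is a multiple of t, so is c ^ n p(1/c), which lies in K
   when n bounds the degree of p and is therefore 0. *)
Let K_inv c : c \in K -> c != 0 -> c^-1 \in K.
Proof.
move=> Kc c0; have uc := K_unit Kc c0; apply: Kmax => p Kp.
have e : c ^+ (size p) * p.[c^-1] = \sum_(j < size p) p`_j * c ^+ (size p - j).
  rewrite horner_coef mulr_sumr; apply: eq_bigr => j _.
  have /subnK {1}<- := ltnW (ltn_ord j).
  by rewrite exprD mulrCA -!mulrA -exprMn (divrr uc) expr1n mulr1.
move=> /(tdvdMl (c ^+ size p)); rewrite e => /Kt h.
apply: (mulrI (unitrX (size p) uc)); rewrite mulr0 e h //.
by apply: rpred_sum => j _; rewrite rpredM ?rpredX // (polyOverP Kp).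
Qed.

(* Euclidean division in K[X] by a polynomial of minimal size among those
   whose value at x vanishes modulo t. *)
Let K_euclid (p : {poly R}) x : p \is a polyOver K -> p != 0 ->
    (forall q, q \is a polyOver K -> q != 0 -> tdvd t 1 q.[x] ->
       (size p <= size q)%N) -> tdvd t 1 p.[x] ->
  forall q, q \is a polyOver K -> tdvd t 1 q.[x] -> exists a, q = a * p.
Proof.
move=> Kp p0 minp px q; move: {2}(size q) (leqnn (size q)) => n.
elim: n q => [|n IH] q szq Kq qx.
  by exists 0; rewrite mul0r; apply/eqP; rewrite -size_poly_eq0 -leqn0.
have [->|q0] := eqVneq q 0; first by exists 0; rewrite mul0r.
have szpq := minp q Kq q0 qx.
have lp0 : lead_coef p != 0 by rewrite lead_coef_eq0.
have Kl (r : {poly R}) : r \is a polyOver K -> lead_coef r \in K.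
  by rewrite lead_coefE => /polyOverP.
pose c := lead_coef q / lead_coef p.
pose s := c%:P * 'X^(size q - size p).
have Kc : c \in K by rewrite rpredM ?K_inv ?Kl.
have Ks : s \is a polyOver K by rewrite rpredM ?polyOverC ?rpredX ?polyOverX.
have [|||a qa] := IH (q - s * p).
- rewrite -ltnS; apply: leq_trans szq.
  have szs : size (s * p) = size q.
    rewrite /s -mulrA [_ * p]mulrC size_Cmul ?size_mulXn ?subnK //.
    by rewrite mulf_neq0 ?lead_coef_eq0 // invr_eq0 lead_coef_eq0.
  have lcs : lead_coef (s * p) = lead_coef q.
    rewrite !lead_coefM lead_coefC lead_coefXn mulr1 divrK //.
    exact: K_unit (Kl _ Kp) lp0.
  rewrite ltn_neqAle; apply/andP; split; last first.
    by apply: leq_trans (size_polyD _ _) _; rewrite size_polyN szs maxnn.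
  apply/eqP => e; have : lead_coef (q - s * p) = 0.
    by move: lcs; rewrite !lead_coefE e coefB szs => ->; rewrite subrr.
  by move/eqP; rewrite lead_coef_eq0 -size_poly_eq0 e size_poly_eq0 (negPf q0).
- by apply: rpredB => //; apply: rpredM.
- by rewrite hornerD hornerN hornerM; apply: tdvdB => //; apply: tdvdMl.
by exists (a + s); rewrite mulrDl -qa subrK.
Qed.

(** If the residue of x is transcendental over K, then K[x] meets the ideal of
    t only in 0 and x is in K. Otherwise take p of minimal size in K[X] with
    p(x) a multiple of t. In characteristic 0 its derivative is a unit at x,
    so p has a root z congruent to x; a q in K[X] with q(z) a multiple of t is
    a multiple of p, hence q(z) = 0, and z is in K. *)
Lemma maximal_coefficient_field : coefficient_field K.
Proof.
split=> // x; have [[pw [Kpw [pw0 pwx]]]|trx] := EM (exists p,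
    p \is a polyOver K /\ p != 0 /\ tdvd t 1 p.[x]); last first.
  exists x; last by rewrite subrr; apply: tdvd0.
  apply: Kmax => p Kp px; suff /eqP -> : p == 0 by rewrite horner0.
  by apply: contrapT => /negP p0; apply: trx; exists p.
have [|p [Kp [p0 px]] minp] := @ex_minimal_size R
  (fun p => p \is a polyOver K /\ p != 0 /\ tdvd t 1 p.[x]) pw => //.
have minp' q : q \is a polyOver K -> q != 0 -> tdvd t 1 q.[x] ->
  (size p <= size q)%N by move=> Kq q0 qx; apply: minp.
have szp : (1 < size p)%N.
  rewrite ltnNge; apply/negP => /size1_polyC pC.
  move: p0 px; rewrite pC hornerC polyC_eq0 => p0 /Kt p00.
  by rewrite p00 ?eqxx // in p0; apply: (polyOverP Kp).
have dp0 : p^`() != 0.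
  apply: deriv_neq0 szp => n.
  by apply: contraTneq (natr_unit n) => ->; rewrite unitr0.
have udp : p^`().[x] \is a GRing.unit.
  case: (unit_or_tdvd dvrR p^`().[x]) => // dpx.
  have := minp' _ (polyOver_deriv Kp) dp0 dpx.
  by rewrite leqNgt lt_size_deriv.
have [z pz zx] := hensel dvrR px udp.
exists z; last by rewrite -opprB; apply: tdvdN.
apply: Kmax => q Kq qz; have [||a ->] := K_euclid Kp p0 minp' px (q := q) => //.
  apply: (tdvd_ind (y := q.[z])) => //; apply: tdvd_horner.
  by rewrite -opprB; apply: tdvdN.
by rewrite hornerM pz mulr0.
Qed.

End Maximal.

(** The image of k is the starting point of the maximality argument: its
    nonzero elements are units, so it meets the ideal of t only in 0. *)
Lemma coefficient_field_exists :
  exists K : subringClosed R, coefficient_field K.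
Proof.
have [||A [clA A0 AZ maxA]] := @maximal_closed_avoiding bool R (@subring_op R)
    (fun x => exists c, x = i c) (fun x => x != 0 /\ tdvd t 1 x).
- move=> [] _ _ [c ->] [d ->] /=; first by exists (c * d); rewrite rmorphM.
  by exists (c - d); rewrite rmorphB.
- move=> _ [c ->] [ic0 /(tdvd1_nonunit dvrR)/negP]; apply.
  by rewrite rmorph_unit // unitfE; apply: contraNneq ic0 => ->;
    rewrite rmorph0.
pose KP : {pred R} := fun x => `[< A x >].
have KP_subring : subring_closed KP.
  split=> [|x y /asboolP Ax /asboolP Ay|x y /asboolP Ax /asboolP Ay];
    apply/asboolP.
  - by apply: A0; exists 1; rewrite rmorph1.
  - exact: (clA false).
  - exact: (clA true).
pose K : subringClosed R := HB.pack KP (GRing.isSubringClosed.Build R KP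
  KP_subring).
exists K; apply: maximal_coefficient_field.
- by move=> c; apply/asboolP/A0; exists c.
- move=> c /asboolP/AZ cZ ct; apply/eqP; apply: contrapT => /negP c0.
  by apply: cZ.
move=> z zK; apply/asboolP.
apply: (maxA (fun x => exists2 p, p \is a polyOver K & x = p.[z])).
- exact: horner_values_closed.
- move=> x Ax; exists x%:P; rewrite ?hornerC // polyOverC; exact/asboolP.
- by move=> x [p Kp ->] [p0 /zK pz]; rewrite pz ?eqxx in p0.
- by exists 'X; rewrite ?hornerX // polyOverX.
Qed.

End CoefficientField.

(** * The logarithmic derivation of a complete discrete valuation ring *)

Record derivation (A : comNzRingType) (d : A -> A) : Prop := Derivation {
  derD : forall x y, d (x + y) = d x + d y;
  derM : forall x y, d (x * y) = d x * y + x * d y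
}.

Section LogDerivation.
Variables (R : idomainType) (t : R) (k : fieldType) (i : {rmorphism k -> R}).
Hypothesis dvrR : complete_dvr t.
Variable K : subringClosed R.
Hypothesis cfK : coefficient_field t i K.

Lemma poly_unif_dense n x :
  exists2 p, p \is a polyOver K & tdvd t n (x - p.[t]).
Proof.
elim: n x => [|n IH] x; first by exists 0; rewrite ?rpred0 //;
  exists (x - 0.[t]); rewrite mulr1.
have [c Kc [y xy]] := coef_field_repr cfK x; have [p Kp py] := IH y.
exists (p * 'X + c%:P); first by rewrite rpredD ?rpredM ?polyOverX ?polyOverC.
rewrite !(hornerD, hornerM, hornerX, hornerC).
have -> : x - (p.[t] * t + c) = (y - p.[t]) * t.
  by rewrite -[x](subrK c) xy expr1; ring.
by rewrite -addn1; apply: tdvdM => //; apply: tdvd_unif.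
Qed.

(** As K meets the ideal of t only in 0, divisibility of p(t) by t ^ n means
    that X ^ n divides p, and X d/dX preserves the multiples of X ^ n. This
    makes t d/dt well defined and continuous. *)
Lemma tdvd_log_deriv n (p : {poly R}) : p \is a polyOver K ->
  tdvd t n p.[t] -> tdvd t n (t * p^`().[t]).
Proof.
elim: n p => [|n IH] p Kp pt; first by exists (t * p^`().[t]); rewrite mulr1.
have Kq : \poly_(j < size p) p`_j.+1 \is a polyOver K.
  by apply: polyOver_poly => j _; apply: (polyOverP Kp).
have pE : p = (\poly_(j < size p) p`_j.+1) * 'X + (p`_0)%:P.
  apply/polyP => j; rewrite coefD coefMX coefC coef_poly.
  case: j => [|j] /=; first by rewrite add0r.
  by rewrite addr0; case: ltnP => // sj; rewrite nth_default // (leqW sj).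
move: (\poly_(_ < _) _) Kq pE => q Kq pE.
have p0 : p`_0 = 0.
  apply: (coef_field_tdvd cfK); first exact: (polyOverP Kp).
  have -> : p`_0 = p.[t] - q.[t] * t.
    by rewrite {2}pE !(hornerD, hornerM, hornerX, hornerC); ring.
  by apply: tdvdB; [apply: tdvd_leq pt | apply: tdvdMl; apply: tdvd_unif].
move: pt; rewrite pE p0 addr0 derivM derivX.
rewrite !(hornerD, hornerM, hornerX, hornerC) mulr1 => pt.
have qt : tdvd t n q.[t] by apply: (tdvdSX dvrR).
have -> : t * (q^`().[t] * t + q.[t]) = (t * q^`().[t]) * t + q.[t] * t by ring.
by apply: tdvdD => //; rewrite -addn1; apply: tdvdM;
  [apply: IH | apply: tdvd_unif].
Qed.

(** The graph of t d/dt, when R is thought of as the power series ring K[[t]]: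
    on polynomials p(t) the derivative is t p'(t), and power series are limits
    of polynomials. *)
Definition log_deriv_rel (x y : R) := forall n, exists p,
  [/\ p \is a polyOver K, tdvd t n (x - p.[t]) & tdvd t n (y - t * p^`().[t])].

Lemma log_deriv_rel_total x : exists y, log_deriv_rel x y.
Proof.
have /choice[p ptx] n : exists p, p \is a polyOver K /\ tdvd t n (x - p.[t]).
  by have [p Kp px] := poly_unif_dense n x; exists p.
have [|y yp] := tdvd_complete dvrR (u := fun n => t * (p n)^`().[t]).
  move=> n; rewrite -mulrBr -hornerN -hornerD -derivN -derivD.
  have [Kp px] := ptx n; have [Kp' px'] := ptx n.+1.
  apply: tdvd_log_deriv; first by rewrite rpredB.
  have -> : (p n.+1 - p n).[t] = x - (p n).[t] - (x - (p n.+1).[t]).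
    by rewrite !hornerE; ring.
  by apply: tdvdB => //; apply: tdvd_leq px'.
exists y => n; exists (p n); have [Kp px] := ptx n; split=> //.
by rewrite -opprB; apply: tdvdN.
Qed.

Lemma log_deriv_rel_fun x y z : log_deriv_rel x y -> log_deriv_rel x z -> y = z.
Proof.
move=> xy xz; apply/eqP; rewrite -subr_eq0;
  apply/eqP/(tdvd_separated dvrR) => n.
have [p [Kp px py]] := xy n; have [q [Kq qx qz]] := xz n.
have -> : y - z =
    (y - t * p^`().[t]) - (z - t * q^`().[t]) + t * (p - q)^`().[t].
  by rewrite derivB hornerD hornerN; ring.
apply: tdvdD; first exact: tdvdB.
apply: tdvd_log_deriv; first by rewrite rpredB.
have -> : (p - q).[t] = (x - q.[t]) - (x - p.[t]) by rewrite !hornerE; ring.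
exact: tdvdB.
Qed.

Lemma log_deriv_relD x y x' y' : log_deriv_rel x y -> log_deriv_rel x' y' ->
  log_deriv_rel (x + x') (y + y').
Proof.
move=> xy xy' n; have [p [Kp px py]] := xy n; have [q [Kq qx qy]] := xy' n.
exists (p + q); split; first by rewrite rpredD.
  by rewrite hornerD opprD addrACA; apply: tdvdD.
by rewrite derivD hornerD mulrDr opprD addrACA; apply: tdvdD.
Qed.

Lemma log_deriv_relM x y x' y' : log_deriv_rel x y -> log_deriv_rel x' y' ->
  log_deriv_rel (x * x') (y * x' + x * y').
Proof.
move=> xy xy' n; have [p [Kp px py]] := xy n; have [q [Kq qx qy]] := xy' n.
exists (p * q); split; first by rewrite rpredM.
  rewrite hornerM.
  have -> : x * x' - p.[t] * q.[t] =
    x' * (x - p.[t]) + p.[t] * (x' - q.[t]) by ring.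
  by apply: tdvdD; apply: tdvdMl.
rewrite derivM hornerD !hornerM.
have -> : y * x' + x * y' - t * (p^`().[t] * q.[t] + p.[t] * q^`().[t])
  = (x' * (y - t * p^`().[t]) + (t * p^`().[t]) * (x' - q.[t]))
    + (x * (y' - t * q^`().[t]) + (t * q^`().[t]) * (x - p.[t])) by ring.
by apply: tdvdD; apply: tdvdD; apply: tdvdMl.
Qed.

Lemma log_derivation_exists : exists d : R -> R,
  [/\ derivation d, forall c, c \in K -> d c = 0 & d t = t].
Proof.
have /choice[d dP] := log_deriv_rel_total; exists d; split.
- split=> x y; apply: log_deriv_rel_fun (dP _) _.
    exact: log_deriv_relD.
  exact: log_deriv_relM.
- move=> c Kc; apply: log_deriv_rel_fun (dP _) _ => n; exists c%:P.
  by rewrite polyOverC hornerC derivC horner0 mulr0 !subrr; split=> //;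
    exact: tdvd0.
apply: log_deriv_rel_fun (dP _) _ => n; exists 'X.
by rewrite polyOverX hornerX derivX hornerC mulr1 !subrr; split=> //;
  exact: tdvd0.
Qed.

End LogDerivation.

(** * Extension of derivations to fractions and to algebraic extensions *)

Section DerivationTheory.
Variables (A : comNzRingType) (d : A -> A).
Hypothesis derd : derivation d.

Lemma der0 : d 0 = 0.
Proof. by apply: (addIr (d 0)); rewrite -(derD derd) !add0r. Qed.

Lemma der1 : d 1 = 0.
Proof.
by apply: (addIr (d 1)); rewrite add0r -{3}[1]mulr1 (derM derd) mulr1 mul1r.
Qed.

Lemma derN x : d (- x) = - d x.
Proof. by apply/eqP; rewrite -addr_eq0 -(derD derd) addNr der0. Qed.

Lemma derX x n : d (x ^+ n.+1) = n.+1%:R * x ^+ n * d x.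
Proof.
elim: n => [|n IH]; first by rewrite !expr1 expr0 !mul1r.
by rewrite exprS (derM derd) IH [in RHS]mulrS !exprS; ring.
Qed.

End DerivationTheory.

(** Characterizes the fraction field up to isomorphism, so that its elements
    are only handled as quotients. *)
Record fraction_field (R : idomainType) (Q : fieldType)
    (iota : {rmorphism R -> Q}) : Prop := FractionField {
  frac_eq0 : forall r, (iota r == 0) = (r == 0);
  frac_repr : forall q, exists a b : R, b != 0 /\ q = iota a / iota b
}.

Lemma fraction_fieldP (R : idomainType) :
  fraction_field (@FracField.tofrac R : {rmorphism R -> {fraction R}}).
Proof.
split=> [|q]; first exact: tofrac_eq0.
suff [a [b [b0 ->]]] : exists a b : R,
    b != 0 /\ q = @FracField.tofrac R a / @FracField.tofrac R b by exists a, b.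
elim/quotW: q => x; exists (frac x).1, (frac x).2; split;
  first exact: denom_ratioP.
have nz : @FracField.tofrac R (frac x).2 != 0.
  by rewrite tofrac_eq0 denom_ratioP.
apply: (mulIf nz); rewrite divfK //.
rewrite !piE; apply/eqmodP; rewrite /= FracField.equivfE /FracField.mulf /=.
by rewrite !numden_Ratio ?mulf_neq0 ?oner_eq0 ?denom_ratioP //; apply/eqP; ring.
Qed.

Section FractionDerivation.
Variables (R : idomainType) (Q : fieldType) (iota : {rmorphism R -> Q}).
Hypothesis fracQ : fraction_field iota.
Variable d : R -> R.
Hypothesis derd : derivation d.

Lemma frac_eq a b : (iota a == iota b) = (a == b).
Proof. by rewrite -subr_eq0 -rmorphB (frac_eq0 fracQ) subr_eq0. Qed.

(* The derivative s of q = a / b is dictated by the product rule for a = q b. *)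
Let rel (q s : Q) := exists a b : R,
  [/\ b != 0, iota a = q * iota b & iota (d a) = s * iota b + q * iota (d b)].

Let rel_total q : exists s, rel q s.
Proof.
have [a [b [b0 ->]]] := frac_repr fracQ q.
have b0' : iota b != 0 by rewrite (frac_eq0 fracQ).
exists ((iota (d a) - iota a / iota b * iota (d b)) / iota b), a, b.
by split; rewrite ?divfK // subrK.
Qed.

Let rel_fun q s s' : rel q s -> rel q s' -> s = s'.
Proof.
move=> [a [b [b0 qa da]]] [a' [b' [b0' qa' da']]].
have /(congr1 d) : a * b' = a' * b.
  by apply/eqP; rewrite -frac_eq !rmorphM qa qa'; apply/eqP; ring.
rewrite !(derM derd) => /(congr1 iota).
rewrite !(rmorphD, rmorphM) da da' qa qa' => e.
have bb0 : iota b * iota b' != 0 by rewrite mulf_neq0 ?(frac_eq0 fracQ).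
apply: (mulIf bb0); apply/eqP; rewrite -subr_eq0; apply/eqP.
by move/eqP: e; rewrite -subr_eq0 => /eqP <-; ring.
Qed.

Lemma fraction_derivation : exists dQ : Q -> Q,
  derivation dQ /\ forall a, dQ (iota a) = iota (d a).
Proof.
have /choice[dQ dQP] := rel_total; exists dQ; split; last first.
  move=> a; apply: rel_fun (dQP _) _; exists a, 1.
  by rewrite oner_neq0 rmorph1 !mulr1 (der1 derd) rmorph0 mulr0 addr0.
split=> x y; apply: rel_fun (dQP _) _;
  have [a [b [b0 xa da]]] := dQP x; have [a' [b' [b0' ya da']]] := dQP y.
  exists (a * b' + a' * b), (b * b'); rewrite mulf_neq0 //; split=> //.
    by rewrite !(rmorphD, rmorphM) xa ya; ring.
  by rewrite !(derD derd, derM derd, rmorphD, rmorphM) da da' xa ya; ring.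
exists (a * a'), (b * b'); rewrite mulf_neq0 //; split=> //.
  by rewrite !(rmorphD, rmorphM) xa ya; ring.
by rewrite !(derD derd, derM derd, rmorphD, rmorphM) da da' xa ya; ring.
Qed.

End FractionDerivation.

Section TotalDerivative.
Variables (Q F : comNzRingType) (j : {rmorphism Q -> F}) (d : Q -> Q).
Hypothesis derd : derivation d.

(** The value at z of the derivative of p, when constants are derived by d and
    z has derivative w. Any derivation D that extends d satisfies D (p(z)) =
    total_derivative z (D z) p. *)
Definition total_derivative (z w : F) (p : {poly Q}) : F :=
  (map_poly j (map_poly d p)).[z] + (map_poly j p^`()).[z] * w.

Local Notation ev z p := (map_poly j p).[z].

Let coef_d p n : (map_poly d p)`_n = d p`_n.
Proof. by rewrite coef_map_id0 // (der0 derd). Qed.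

Lemma total_derivativeD z w p q : total_derivative z w (p + q) =
  total_derivative z w p + total_derivative z w q.
Proof.
rewrite /total_derivative derivD.
have -> : map_poly d (p + q) = map_poly d p + map_poly d q.
  by apply/polyP => n; rewrite coefD !coef_d coefD (derD derd).
by rewrite !rmorphD !hornerD; ring.
Qed.

Lemma total_derivativeMX z w p : total_derivative z w (p * 'X) =
  total_derivative z w p * z + ev z p * w.
Proof.
rewrite /total_derivative derivM derivX mulr1.
have -> : map_poly d (p * 'X) = map_poly d p * 'X.
  apply/polyP => n; rewrite coefMX !coef_d coefMX.
  by case: n => //=; rewrite (der0 derd).
rewrite !(rmorphD, rmorphM) /= !map_polyX !(hornerD, hornerMX); ring.
Qed.

Lemma total_derivativeC z w c : total_derivative z w c%:P = j (d c).
Proof.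
rewrite /total_derivative derivC rmorph0 horner0 mul0r addr0.
have -> : map_poly d c%:P = (d c)%:P.
  by apply/polyP => n; rewrite coef_d !coefC; case: ifP => //;
    rewrite (der0 derd).
by rewrite map_polyC hornerC.
Qed.

Lemma total_derivative0 z w : total_derivative z w 0 = 0.
Proof. by rewrite -polyC0 total_derivativeC (der0 derd) rmorph0. Qed.

Lemma total_derivativeM z w p q : total_derivative z w (p * q) =
  total_derivative z w p * ev z q + ev z p * total_derivative z w q.
Proof.
elim/poly_ind: q => [|q c IH].
  by rewrite mulr0 total_derivative0 rmorph0 horner0 !mulr0 addr0.
have CM r : total_derivative z w (r * c%:P) =
    total_derivative z w r * j c + ev z r * j (d c).
  elim/poly_ind: r => [|r e IHr].
    by rewrite mul0r total_derivative0 rmorph0 horner0 !mul0r addr0.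
  rewrite mulrDl -mulrA ['X * _]mulrC mulrA -polyCM !total_derivativeD.
  rewrite !total_derivativeMX !total_derivativeC IHr (derM derd).
  rewrite !(rmorphD, rmorphM) /= !(map_polyX, map_polyC).
  rewrite !(hornerD, hornerMX, hornerC, hornerM).
  ring.
rewrite mulrDr mulrA !total_derivativeD !total_derivativeMX !total_derivativeC
  CM IH.
rewrite !(rmorphD, rmorphM) /= !(map_polyX, map_polyC).
rewrite !(hornerD, hornerMX, hornerC, hornerM).
ring.
Qed.

Lemma total_derivative_comp z w p q :
  total_derivative z w (p \Po q) =
  total_derivative (ev z q) (total_derivative z w q) p.
Proof.
elim/poly_ind: p => [|p c IH]; first by rewrite comp_poly0 !total_derivative0.
rewrite comp_polyD comp_polyM comp_polyX comp_polyC !total_derivativeD.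
rewrite !total_derivativeC total_derivativeMX total_derivativeM IH.
by rewrite map_comp_poly horner_comp.
Qed.

End TotalDerivative.

Lemma derivation_horner (Q F : comNzRingType) (f : {rmorphism Q -> F})
    (d : Q -> Q) (D : F -> F) z p :
  derivation d -> derivation D -> (forall c, D (f c) = f (d c)) ->
  D (map_poly f p).[z] = total_derivative f d z (D z) p.
Proof.
move=> derd derDF Df; elim/poly_ind: p => [|p c IH].
  by rewrite rmorph0 horner0 (der0 derDF) total_derivative0.
rewrite total_derivativeD // total_derivativeMX // total_derivativeC //.
rewrite !(rmorphD, rmorphM) /= map_polyX map_polyC hornerD hornerMX hornerC.
by rewrite (derD derDF) (derM derDF) IH Df.
Qed.

Section AlgebraicExtension.
Variables (Q F : fieldType) (j : {rmorphism Q -> F}) (d : Q -> Q).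
Hypotheses (derd : derivation d) (chQ : [pchar Q] =i pred0).
Hypothesis algF : forall x : F, algebraicOver j x.

Local Notation ev z p := (map_poly j p).[z].

(** The minimal polynomial up to a constant. Its derivative does not vanish at
    x because the characteristic is 0. *)
Lemma minimal_annihilator x : exists p : {poly Q},
  [/\ p != 0, (1 < size p)%N, ev x p = 0, ev x p^`() != 0
    & forall q, ev x q = 0 -> p %| q].
Proof.
have [p0 p00 /eqP p0x] := algF x.
have [|p [pn0 px] minp] := @ex_minimal_size Q
  (fun p => p != 0 /\ ev x p = 0) p0.
  by split.
have minp' q : q != 0 -> ev x q = 0 -> (size p <= size q)%N.
  by move=> q0 qx; apply: minp.
have szp : (1 < size p)%N.
  rewrite ltnNge; apply/negP => /size1_polyC pC.
  move: pn0 px; rewrite pC map_polyC hornerC polyC_eq0 => c0 /eqP.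
  by rewrite fmorph_eq0 (negPf c0).
exists p; split=> //.
  have dp0 : p^`() != 0.
    by apply: deriv_neq0 szp => n; rewrite ((pcharf0P Q).1 chQ).
  apply/eqP => /(minp' _ dp0); rewrite leqNgt lt_size_deriv //.
move=> q qx; rewrite /dvdp; apply: contraT => r0.
have rx : ev x (q %% p) = 0.
  have := congr1 (fun r => ev x r) (divp_eq q p).
  by rewrite /= rmorphD rmorphM hornerD hornerM px mulr0 add0r qx.
by have := minp' _ r0 rx; rewrite leqNgt ltn_modp pn0.
Qed.

(* The possible values y of the derivative of x, read off the polynomial
   relations of x. *)
Let rel (x y : F) := forall p, ev x p = 0 -> total_derivative j d x y p = 0.

Let rel_total x : exists y, rel x y.
Proof.
have [p [_ _ px dpx pmin]] := minimal_annihilator x.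
exists (- ev x (map_poly d p) / ev x p^`()) => q /pmin/dvdpP[r ->].
rewrite (total_derivativeM j derd) px mulr0 add0r /total_derivative.
by rewrite [_.[x] * (_ / _)]mulrC divfK // subrr mulr0.
Qed.

Let rel_fun x y y' : rel x y -> rel x y' -> y = y'.
Proof.
have [p [_ _ px dpx _]] := minimal_annihilator x.
move=> /(_ p px)/eqP; rewrite /total_derivative addrC addr_eq0 => /eqP e.
move=> /(_ p px)/eqP; rewrite /total_derivative addrC addr_eq0 -e => /eqP e'.
exact: (mulfI dpx).
Qed.

Let rel_comp z w p : rel z w -> rel (ev z p) (total_derivative j d z w p).
Proof.
move=> zw q qz; rewrite -(total_derivative_comp j derd); apply: zw.
by rewrite map_comp_poly horner_comp.
Qed.

(** The relation p(x) = 0, for p the minimal polynomial, forces the value of D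
    x, since p'(x) is not 0, and every other relation is a multiple of p. By
    the primitive element theorem two elements are polynomials in one z, and
    on such polynomials D is the total derivative, which obeys the sum and
    product rules. *)
Lemma algebraic_derivation : exists D : F -> F,
  derivation D /\ forall c, D (j c) = j (d c).
Proof.
have /choice[D DP] := rel_total.
have DE z p : D (ev z p) = total_derivative j d z (D z) p.
  exact: rel_fun (DP _) (rel_comp (DP z)).
exists D; split; last first.
  move=> c; have := DE 1 c%:P.
  by rewrite map_polyC hornerC total_derivativeC.
have prim x y : exists z p q, x = ev z p /\ y = ev z q.
  have [p p0 px] := algF x; have [q q0 qy] := algF y.
  have [n [[a ax] [b bx]]] := pchar0_PET p0 px q0 qy chQ.
  by exists (y *+ n - x), a, b.
split=> x y; have [z [p [q [-> ->]]]] := prim x y.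
  by rewrite -hornerD -rmorphD !DE total_derivativeD.
by rewrite -hornerM -rmorphM !DE total_derivativeM.
Qed.

End AlgebraicExtension.

(** * Valuation rings *)

Lemma poly_split_const (A : nzRingType) (p : {poly A}) :
  p = (\poly_(n < (size p).-1) p`_n.+1) * 'X + (p`_0)%:P.
Proof.
apply/polyP => n; rewrite coefD coefMX coefC coef_poly.
case: n => [|n] /=; first by rewrite add0r.
by rewrite addr0 ltn_predRL; case: ltnP => // sn; rewrite nth_default.
Qed.

Section ValuationRing.
Variables (F : fieldType) (u : F).

Record valuation_ring (V : F -> Prop) : Prop := ValuationRing {
  valr1 : V 1;
  valrB : forall x y, V x -> V y -> V (x - y);
  valrM : forall x y, V x -> V y -> V (x * y);
  valr_total : forall x, V x \/ V x^-1
}.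

(* Here V is maximal among the subrings of F that contain u but not its
   inverse. *)
Section Existence.
Variable V : subringClosed F.
Hypotheses (Vu : u \in V) (VuV : u^-1 \notin V).
Hypothesis Vmax : forall z,
  (forall p, p \is a polyOver V -> p.[z] <> u^-1) -> z \in V.

Let u0 : u != 0.
Proof. by apply: contraNneq VuV => ->; rewrite invr0 rpred0. Qed.

(* Inverting 1 - u a does not bring in the inverse of u: clear denominators
   with a power of 1 - u a, which is congruent to 1 modulo u. *)
Let one_sub_inv a : a \in V -> (1 - u * a)^-1 \in V.
Proof.
move=> Va; have Vs : 1 - u * a \in V by rewrite rpredB ?rpredM ?rpred1.
have [->|s0] := eqVneq (1 - u * a) 0; first by rewrite invr0 rpred0.
apply: Vmax => p Vp pu; move/negP: VuV; apply.
have [b Vb sb] : exists2 b, b \in V & (1 - u * a) ^+ (size p) = 1 + u * b.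
  elim: (size p) => [|n [b Vb sb]]; first by exists 0;
    rewrite ?rpred0 // mulr0 addr0.
  exists (b - a * (1 + u * b));
    first by rewrite rpredB ?rpredM ?rpredD ?rpred1 ?rpredM.
  by rewrite exprS sb; ring.
have : (1 - u * a) ^+ (size p) * p.[(1 - u * a)^-1] \in V.
  rewrite horner_coef mulr_sumr rpred_sum // => n _.
  have /subnK {1}<- := ltnW (ltn_ord n).
  rewrite exprD mulrCA exprVn -[_ * _ / _]mulrA divff ?expf_neq0 // mulr1.
  by rewrite rpredM ?rpredX // (polyOverP Vp).
rewrite sb pu mulrDl mul1r mulrAC divff // mul1r => h.
by rewrite -(addrK b u^-1) rpredB.
Qed.

Let coef_inv x (p : {poly F}) n : x != 0 -> (size p <= n.+1)%N ->
  (\poly_(m < n.+1) p`_(n - m)).[x] = x ^+ n * p.[x^-1].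
Proof.
move=> x0 szp; rewrite (horner_coef_wide _ szp) mulr_sumr.
rewrite (horner_coef_wide _ (size_poly _ _)) (reindex_inj rev_ord_inj) /=.
apply: eq_bigr => m _; rewrite coef_poly subSS ltnS leq_subr.
have mn : (m <= n)%N by rewrite -ltnS.
rewrite subKn // exprVn mulrCA; congr (_ * _).
by apply: (mulIf (expf_neq0 m x0)); rewrite divfK ?expf_neq0 // -exprD subnK.
Qed.

(** Suppose that neither x nor its inverse is in V. Then 1/u is a polynomial
    over V both in x and in 1/x; take both of minimal degree, say with the
    degree n in x at least that in 1/x. As 1 - u q_0 is a unit, the relation
    in 1/x, multiplied by x ^ n, expresses x ^ n by lower powers of x, and
    substituting this in the other relation lowers its degree. *)
Lemma maximal_valuation_ring : valuation_ring (fun x => x \in V).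
Proof.
split=> [|x y|x y|x]; [exact: rpred1 | exact: rpredB | exact: rpredM |].
apply: contrapT => nV.
have inv z : z \notin V -> exists2 p, p \is a polyOver V /\ p.[z] = u^-1 &
    forall q, q \is a polyOver V /\ q.[z] = u^-1 -> (size p <= size q)%N.
  move=> zV; apply: contrapT => nex; move/negP: zV; apply;
    apply: Vmax => p Vp pz.
  by apply: nex; apply: (ex_minimal_size (p0 := p)).
have [xV xVV] : x \notin V /\ x^-1 \notin V.
  by split; apply/negP => h; apply: nV; [left | right].
have {nV} [p [Vp px] pmin] := inv _ xV.
have [q [Vq qx] qmin] := inv _ xVV.
wlog szpq : x p q xV xVV Vp Vq px qx pmin qmin / (size q <= size p)%N.
  move=> W; have /orP[h|h] := leq_total (size q) (size p);
    first exact: (W x p q).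
  by apply: (W x^-1 q p); rewrite ?invrK.
have x0 : x != 0 by apply: contraNneq xV => ->; rewrite rpred0.
(* q = q1 X + q_0, so that u q1(1/x) / x = 1 - u q_0 is the unit e. *)
move: (poly_split_const q);
  move: (\poly_(_ < _) _) (size_poly (size q).-1 (fun n => q`_n.+1)) =>
  q1 szq1 qE.
have Vq0 : q`_0 \in V by apply: (polyOverP Vq).
have Vq1 n : q1`_n \in V.
  by have := polyOverP Vq n.+1; rewrite {1}qE coefD coefMX coefC /= addr0.
have szq : (1 < size q)%N.
  rewrite ltnNge; apply/negP => /size1_polyC qC; move: qx;
    rewrite qC hornerC => qu.
  by move/negP: VuV; apply; rewrite -qu.
have [n szp] : exists n, size p = n.+2 by exists (size p).-2;
  case: (size p) (leq_trans szq szpq) => [|[|]].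
pose e := 1 - u * q`_0.
have eq1 : u * (q1.[x^-1] / x) = e.
  by rewrite /e -[1](mulfV u0) -qx {1}qE hornerD hornerMX hornerC; ring.
have e0 : e != 0.
  apply/eqP => e0; move/negP: VuV; apply.
  suff -> : u^-1 = q`_0 by [].
  by apply: (mulfI u0); rewrite mulfV //; apply/eqP; rewrite -subr_eq0 -/e e0.
pose r := \poly_(m < n.+1) (q1`_(n - m)).
have Vr : r \is a polyOver V by apply: polyOver_poly => m _; apply: Vq1.
have rx : u / e * r.[x] = x ^+ n.+1.
  rewrite coef_inv //; last first.
    by apply: leq_trans szq1 _; rewrite -ltnS prednK ?(ltnW szq) // -szp.
  have ex : u * q1.[x^-1] = e * x by rewrite -eq1 -mulrA divfK.
  have -> : u / e * (x ^+ n * q1.[x^-1]) = u * q1.[x^-1] / e * x ^+ n by ring.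
  by rewrite ex [e * x]mulrC mulfK // exprS.
pose p' := \poly_(m < n.+1) p`_m + (p`_n.+1 * (u / e))%:P * r.
have : (size p <= size p')%N.
  apply: pmin; split.
    rewrite rpredD ?polyOver_poly //.
      by move=> m _; apply: (polyOverP Vp).
    rewrite rpredM // polyOverC rpredM ?(polyOverP Vp) // rpredM //.
    exact: one_sub_inv.
  rewrite hornerD hornerCM -mulrA rx -px horner_poly [RHS]horner_coef szp.
  by rewrite [RHS]big_ord_recr.
rewrite szp leqNgt ltnS => /negP; apply.
apply: leq_trans (size_polyD _ _) _; rewrite geq_max size_poly /=.
by rewrite mul_polyC (leq_trans (size_scale_leq _ _)) // size_poly.
Qed.

End Existence.

Lemma valuation_ring_exists (A0 : F -> Prop) :
  closed_under (@subring_op F) A0 -> A0 1 -> A0 u -> ~ A0 u^-1 ->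
  exists V, [/\ valuation_ring V, forall x, A0 x -> V x & ~ V u^-1].
Proof.
move=> clA0 A01 A0u A0uV.
have [||A [clA A0A AZ maxA]] := @maximal_closed_avoiding bool F (@subring_op F)
    A0 (fun x => x = u^-1) => //.
  by move=> x A0x xu; apply: A0uV; rewrite -xu.
pose VP : {pred F} := fun x => `[< A x >].
have VP_subring : subring_closed VP.
  split=> [|x y /asboolP Ax /asboolP Ay|x y /asboolP Ax /asboolP Ay];
    apply/asboolP.
  - exact: A0A.
  - exact: (clA false).
  - exact: (clA true).
pose V : subringClosed F := HB.pack VP (GRing.isSubringClosed.Build F VP
  VP_subring).
have [||z zV|V1 VB VM Vt] := @maximal_valuation_ring V.
- by apply/asboolP/A0A.
- by apply/asboolP => /AZ.
- apply/asboolP.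
  apply: (maxA (fun x => exists2 p, p \is a polyOver V & x = p.[z])).
  + exact: horner_values_closed.
  + move=> x Ax; exists x%:P; rewrite ?hornerC // polyOverC; exact/asboolP.
  + by move=> x [p Vp ->]; apply: zV.
  + by exists 'X; rewrite ?hornerX // polyOverX.
exists A; split=> [|//|/AZ //]; split.
- exact: A0A.
- by move=> x y; apply: (clA false).
- by move=> x y; apply: (clA true).
by move=> x; have [/asboolP|/asboolP] := Vt x; [left | right].
Qed.

Section Theory.
Variable V : F -> Prop.
Hypothesis valV : valuation_ring V.

Lemma valr0 : V 0.
Proof. by rewrite -(subrr 1); apply: (valrB valV); apply: (valr1 valV). Qed.

Lemma valrN x : V x -> V (- x).
Proof. by rewrite -sub0r; apply: (valrB valV); apply: valr0. Qed.

Lemma valrD x y : V x -> V y -> V (x + y).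
Proof. by move=> Vx Vy; rewrite -[y]opprK; apply: (valrB valV) => //;
  apply: valrN. Qed.

Lemma valrX x n : V x -> V (x ^+ n).
Proof.
by move=> Vx; elim: n => [|n IH]; [apply: (valr1 valV) | rewrite exprS;
  apply: (valrM valV)].
Qed.

Lemma valr_sum (I : Type) (r : seq I) (P : pred I) (f : I -> F) :
  (forall a, P a -> V (f a)) -> V (\sum_(a <- r | P a) f a).
Proof. by move=> Vf; apply: big_ind => //; [apply: valr0 | apply: valrD]. Qed.

Lemma valr_horner (p : {poly F}) x : (forall n, V p`_n) -> V x -> V p.[x].
Proof.
move=> Vp Vx; rewrite horner_coef; apply: valr_sum => n _.
by apply: (valrM valV) => //; apply: valrX.
Qed.

(** If 1/x is in V, then dividing the equation of x by x ^ n, one less than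
    its degree, writes x as a polynomial in 1/x. *)
Lemma valr_integral (p : {poly F}) x :
  p \is monic -> (forall n, V p`_n) -> root p x -> V x.
Proof.
move=> monp Vp /eqP px; have [//|VxV] := valr_total valV x.
have [->|x0] := eqVneq x 0; first exact: valr0.
have [n szp] : exists n, size p = n.+1.
  by exists (size p).-1; rewrite prednK // size_poly_gt0 monic_neq0.
case: n => [|n] in szp.
  by move: px; rewrite (size1_polyC (eq_leq szp)) hornerC => p0;
    move/monic_neq0: monp; rewrite (size1_polyC (eq_leq szp)) p0 eqxx.
move: px; rewrite horner_coef szp big_ord_recr /=.
have -> : p`_n.+1 = 1 by move/monicP: monp; rewrite lead_coefE szp.
rewrite mul1r addrC => /eqP; rewrite addr_eq0 => /eqP xn.
have -> : x = x ^+ n.+1 * x^-1 ^+ n.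
  by rewrite exprS -mulrA -exprMn mulfV // expr1n mulr1.
rewrite xn mulNr mulr_suml; apply: valrN; apply: valr_sum => m _.
have mn : (m <= n)%N by rewrite -ltnS.
have -> : x^-1 ^+ n = x^-1 ^+ m * x^-1 ^+ (n - m) by rewrite -exprD subnKC.
rewrite mulrA -[_ * _ * _ ^+ m]mulrA -exprMn mulfV // expr1n mulr1.
by apply: (valrM valV) => //; apply: valrX.
Qed.

Lemma valr_root x n : V (x ^+ n.+1) -> V x.
Proof.
move=> Vxn; apply: (@valr_integral ('X^(n.+1) - (x ^+ n.+1)%:P)).
- exact: monicXnsubC.
- move=> m; rewrite coefB coefXn coefC; apply: (valrB valV).
    by case: eqP => _; [apply: (valr1 valV) | apply: valr0].
  by case: eqP => _ //; apply: valr0.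
- by rewrite rootE hornerD hornerN hornerXn hornerC subrr.
Qed.

(** The maximal ideal of V; that its elements are in V is valr_maxW. *)
Definition valr_max x := x = 0 \/ ~ V x^-1.

Lemma valr_maxW x : valr_max x -> V x.
Proof. by case=> [->|]; [apply: valr0 | case: (valr_total valV x)]. Qed.

Lemma valr_maxMl a x : V a -> valr_max x -> valr_max (a * x).
Proof.
move=> Va mx; have [->|ax0] := eqVneq (a * x) 0; first by left.
right=> Vax; case: mx => [x0|]; first by rewrite x0 mulr0 eqxx in ax0.
apply; have -> : x^-1 = a * (a * x)^-1.
  by move: ax0; rewrite mulf_eq0 negb_or => /andP[a0 x0]; field; apply/andP.
exact: (valrM valV).
Qed.

Lemma valr_maxD x y : valr_max x -> valr_max y -> valr_max (x + y).
Proof.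
have [->|x0] := eqVneq x 0; first by rewrite add0r.
have [->|y0] := eqVneq y 0; first by rewrite addr0.
move=> mx my; have [h|h] := valr_total valV (x / y).
  have -> : x + y = (x / y + 1) * y by rewrite mulrDl divfK // mul1r.
  by apply: valr_maxMl => //; apply: valrD => //; apply: (valr1 valV).
have -> : x + y = (1 + (x / y)^-1) * x
  by rewrite invf_div mulrDl divfK // mul1r.
by apply: valr_maxMl => //; apply: valrD => //; apply: (valr1 valV).
Qed.

Lemma valr_max_unit x : V x -> ~ valr_max x -> x != 0 /\ V x^-1.
Proof.
move=> Vx nmx; split; first by apply/eqP => x0; apply: nmx; left.
by apply: contrapT => h; apply: nmx; right.
Qed.

Lemma valr_max_notin x : V x^-1 -> x != 0 -> ~ valr_max x.
Proof. by move=> Vx x0 [e|//]; rewrite e eqxx in x0. Qed.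

End Theory.

End ValuationRing.

(** * The retraction of a valuation ring onto the base ring *)

Section DvrExtension.
Variables (R : idomainType) (t : R) (Q F : fieldType).
Variables (iota : {rmorphism R -> Q}) (j : {rmorphism Q -> F}).
Hypotheses (dvrR : complete_dvr t) (fracQ : fraction_field iota).
Let rho : {rmorphism R -> F} := j \o iota.

Lemma clear_denominators (p : {poly Q}) :
  exists2 c : R, c != 0 & exists P : {poly R}, iota c *: p = map_poly iota P.
Proof.
elim/poly_ind: p => [|p q [c c0 [P cp]]].
  by exists 1; [exact: oner_neq0 | exists 0; rewrite rmorph0 scaler0].
have [a [b [b0 ->]]] := frac_repr fracQ q.
exists (c * b); first exact: mulf_neq0.
exists ((b *: P) * 'X + (c * a)%:P).
rewrite rmorphD /= [map_poly _ (_ * _)]rmorphM /= map_polyZ /= map_polyX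
  map_polyC /= -cp.
rewrite scalerDr scalerAl !rmorphM scalerA; congr (_ * _ + _).
  by rewrite mulrC.
rewrite -mul_polyC -!polyCM; congr _%:P.
by rewrite -mulrA [iota b * _]mulrC divfK // (frac_eq0 fracQ).
Qed.

Lemma rho_eq0 r : (rho r == 0) = (r == 0).
Proof. by rewrite fmorph_eq0 (frac_eq0 fracQ). Qed.

Lemma rho_unitV r : r \is a GRing.unit -> (rho r)^-1 = rho r^-1.
Proof.
move=> ur; apply: (mulIf (_ : rho r != 0)).
  by rewrite rho_eq0; apply: contraTneq ur => ->; rewrite unitr0.
by rewrite mulVf -?rmorphM ?mulVr ?rmorph1 // rho_eq0;
  apply: contraTneq ur => ->; rewrite unitr0.
Qed.

(** If q is not in R, then q is a unit divided by t ^ (n+1), and a multiple of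
    t ^ n brings it to 1/t. So a subring of Q that contains R and omits 1/t is
    R itself. *)
Lemma fraction_dichotomy (q : Q) :
  (exists r, q = iota r) \/ (exists r, iota r * q = (iota t)^-1).
Proof.
have t0 : iota t != 0 by rewrite (frac_eq0 fracQ) (unif_neq0 dvrR).
have [a [b [b0 ->]]] := frac_repr fracQ q.
have [->|a0] := eqVneq a 0; first by left; exists 0; rewrite rmorph0 mul0r.
have [n [c [uc ->]]] := unit_unif_decomp dvrR a0.
have [m [d [ud ->]]] := unit_unif_decomp dvrR b0.
have unz (e : R) : e \is a GRing.unit -> iota e != 0.
  by move=> ue; rewrite (frac_eq0 fracQ); apply: contraTneq ue => ->;
    rewrite unitr0.
have invE (e : R) : e \is a GRing.unit -> (iota e)^-1 = iota (e^-1).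
  move=> ue; apply: (mulIf (unz _ ue)).
  by rewrite mulVf ?unz // -rmorphM mulVr // rmorph1.
case: (leqP m n) => [mn|nm].
  left; exists (c / d * t ^+ (n - m)).
  rewrite -(subnK mn) addnK !exprD !rmorphM !rmorphXn -(invE _ ud).
  by field; rewrite (unz d) //= expf_neq0.
right; exists (d / c * t ^+ (m - n.+1)).
rewrite -{2}(subnK nm) addnS exprS exprD !rmorphM !rmorphXn -(invE _ uc).
by field; rewrite (unz c) // (unz d) // t0 !expf_neq0.
Qed.

Hypothesis algF : forall x : F, algebraicOver j x.

(** The nonzero constant term of an equation of minimal degree, up to sign. It
    serves as an inverse of x inside R[x], up to a denominator. *)
Lemma algebraic_annihilator (x : F) : x != 0 ->
  exists2 c, c != 0 & exists P : {poly R}, rho c = x * (map_poly rho P).[x].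
Proof.
move=> x0; have [p0 p00 /eqP p0x] := algF x.
have [|p [pn0 px] minp] := @ex_minimal_size Q
  (fun p => p != 0 /\ (map_poly j p).[x] = 0) p0; first by split.
have [c c0 [P cP]] := clear_denominators p.
have P0 : P`_0 != 0.
  apply/eqP => P0.
  have p_0 : p`_0 = 0.
    apply: (mulfI (_ : iota c != 0)); first by rewrite (frac_eq0 fracQ).
    by rewrite mulr0 -coefZ cP coef_map /= P0 rmorph0.
  have := poly_split_const p; rewrite p_0 addr0.
  move: (\poly_(_ < _) _) (size_poly (size p).-1 (fun n => p`_n.+1)) =>
    q szq pq.
  have q0 : q != 0 by apply: contraNneq pn0 => q0; rewrite pq q0 mul0r.
  have : (size p <= size q)%N.
    apply: minp; split=> //; apply: (mulIf x0); rewrite mul0r -px pq.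
    by rewrite rmorphM /= map_polyX hornerMX.
  by rewrite pq size_mulX // ltnn.
exists P`_0 => //; exists (- \poly_(n < (size P).-1) P`_n.+1).
have : (map_poly rho P).[x] = 0.
  by rewrite map_poly_comp -cP map_polyZ hornerZ px mulr0.
rewrite {1}(poly_split_const P) rmorphD rmorphM /= map_polyX map_polyC hornerD
  hornerMX hornerC.
move/eqP; rewrite addrC addr_eq0 => /eqP e; apply: etrans e _.
by rewrite rmorphN hornerN mulrN mulrC.
Qed.

Variable V : F -> Prop.
Hypotheses (valV : valuation_ring V) (VR : forall r, V (rho r)).
Hypothesis VtV : ~ V (rho t)^-1.

Lemma valr_fraction q : V (j q) -> exists r, q = iota r.
Proof.
move=> Vq; have [//|[r rq]] := fraction_dichotomy q; case: VtV.
have -> : (rho t)^-1 = rho r * j q.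
  by rewrite -[rho r]/(j (iota r)) -rmorphM rq fmorphV.
exact: (valrM valV).
Qed.

Lemma valr_int (x : F) : integralOver rho x -> V x.
Proof.
case=> p monp px; apply: (valr_integral valV (p := map_poly rho p)) => //.
  exact: monic_map.
move=> n; rewrite coef_map; exact: VR.
Qed.

(** If x is not in V, then 1/x is, and algebraic_annihilator writes c x with c
    in R as a polynomial in 1/x. *)
Lemma valr_denominator (x : F) : exists n, V (rho t ^+ n * x).
Proof.
have [Vx|VxV] := valr_total valV x; first by exists 0%N; rewrite mul1r.
have [->|x0] := eqVneq x 0; first by exists 0%N; rewrite mulr0;
  apply: (valr0 valV).
have [|c c0 [P cP]] := @algebraic_annihilator x^-1; first by rewrite invr_eq0.
have [n [v [uv cv]]] := unit_unif_decomp dvrR c0.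
exists n; have v0 : rho v != 0.
  by rewrite rho_eq0; apply: contraTneq uv => ->; rewrite unitr0.
have -> : rho t ^+ n * x = rho v^-1 * (map_poly rho P).[x^-1].
  rewrite -rho_unitV //; apply: (mulfI v0); rewrite [RHS]mulrA mulfV // mul1r.
  by rewrite mulrA -rmorphXn -rmorphM -cv cP mulrC mulrA mulfV // mul1r.
apply: (valrM valV) => //; apply: (valr_horner valV) => // m.
rewrite coef_map; exact: VR.
Qed.

(* Here W is maximal among the R-submodules of F that contain V and meet Q
   only in R. *)
Section Retraction.
Variable W : F -> Prop.
Hypothesis clW : forall r x y, W x -> W y -> W (rho r * x - y).
Hypotheses (VW : forall x, V x -> W x)
  (WQ : forall q, W (j q) -> exists r, q = iota r).
Hypothesis maxW : forall B : F -> Prop,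
  (forall r x y, B x -> B y -> B (rho r * x - y)) -> (forall x, W x -> B x) ->
  (forall q, B (j q) -> exists r, q = iota r) -> forall x, B x -> W x.

Let t0 : rho t != 0. Proof. by rewrite rho_eq0 (unif_neq0 dvrR). Qed.

Let W0 : W 0. Proof. by apply: VW; apply: (valr0 valV). Qed.

Let WN x : W x -> W (- x).
Proof. by move=> Wx; rewrite -sub0r -(mulr0 (rho 0)); apply: clW. Qed.

Let WM r x : W x -> W (rho r * x).
Proof. by move=> Wx; rewrite -[_ * x]subr0; apply: clW. Qed.

Let WD x y : W x -> W y -> W (x + y).
Proof. by move=> Wx /WN Wy; rewrite -[x]mul1r -(rmorph1 rho) -[y]opprK;
  apply: clW. Qed.

Let WB x y : W x -> W y -> W (x - y).
Proof. by move=> Wx /WN Wy; apply: WD. Qed.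

(* By maximality W + R z contains some q = w + r z in Q but not in R. If t
   divided r, then q would be in W; so r is a unit and z is q / r modulo W. *)
Let split1 z : W (rho t * z) -> exists q, W (z - j q).
Proof.
move=> Wtz; have [Wz|Wz] := EM (W z); first by exists 0; rewrite rmorph0 subr0.
pose B x := exists2 w, W w & exists r, x = w + rho r * z.
have [[q [[w Ww [r qE]] qR]]|nq] :=
    EM (exists q, B (j q) /\ ~ exists r, q = iota r); last first.
  case: Wz; apply: (maxW (B := B)).
  - move=> r _ _ [w Ww [a ->]] [w' Ww' [a' ->]].
    exists (rho r * w - w'); first exact: clW.
    by exists (r * a - a'); rewrite rmorphB rmorphM; ring.
  - by move=> x Wx; exists x => //; exists 0; rewrite rmorph0 mul0r addr0.
  - by move=> q Bq; apply: contrapT => qR; apply: nq; exists q.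
  - by exists 0 => //; exists 1; rewrite rmorph1 mul1r add0r.
have [ur|[y ry]] := unit_or_tdvd dvrR r; last first.
  case: qR; apply: WQ; rewrite qE ry expr1 rmorphM -mulrA; apply: WD => //.
  exact: WM.
exists (q / iota r); have -> : z - j (q / iota r) = - (rho r^-1 * w).
  have r0 : rho r != 0 by rewrite rho_eq0; apply: contraTneq ur => ->;
    rewrite unitr0.
  rewrite rmorphM fmorphV -/(rho r) qE -(rho_unitV ur); field; exact: r0.
by apply/WN/WM.
Qed.

Let splitW x : exists q, W (x - j q).
Proof.
have [n] := valr_denominator x; move/VW; elim: n x => [|n IH] x.
  by rewrite mul1r => Wx; exists 0; rewrite rmorph0 subr0.
rewrite exprSr -mulrA => /IH[q Wq].
have [|q' Wq'] := split1 (z := x - j (q / iota t)).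
  rewrite mulrBr rmorphM fmorphV -/(rho t) [j q / _]mulrC mulrA mulfV //.
  by rewrite mul1r.
by exists (q / iota t + q'); rewrite rmorphD opprD addrA.
Qed.

(* The retraction sends x to the q in Q for which x - q is infinitely
   divisible by t in W. Being defined modulo a Q-subspace, it is linear;
   uniqueness is separatedness of R and existence is completeness. *)
Let rel (x : F) (q : Q) := forall n, W ((x - j q) / rho t ^+ n).

Let tn0 n : rho t ^+ n != 0. Proof. exact: expf_neq0. Qed.

Let rel_fun x q q' : rel x q -> rel x q' -> q = q'.
Proof.
move=> xq xq'; apply/eqP; rewrite -subr_eq0.
have qq n : exists r, (q - q') = iota (r * t ^+ n).
  have [|r rE] := WQ (q := (q - q') / (iota t) ^+ n).
    rewrite rmorphM fmorphV rmorphXn rmorphB.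
    have -> : j q - j q' = (x - j q') - (x - j q) by ring.
    by rewrite mulrBl; apply: WB; [apply: xq' | apply: xq].
  exists r; rewrite rmorphM rmorphXn -rE divfK //.
  by rewrite expf_neq0 // (frac_eq0 fracQ) (unif_neq0 dvrR).
have [r0 r0E] := qq 0%N; rewrite mulr1 in r0E.
rewrite r0E (frac_eq0 fracQ); apply/eqP/(tdvd_separated dvrR) => n.
have [r rE] := qq n; exists r; apply/eqP; rewrite -(frac_eq fracQ) -r0E;
  exact/eqP.
Qed.

(* Modulo t ^ n W, the element x of V is some r_n in R, because W + Q is all
   of F and W meets Q in R; the sequence r converges t-adically. *)
Let rel_total_V x : V x -> exists q, rel x q.
Proof.
move=> Vx.
have /choice[r rP] n : exists r, W ((x - rho r) / rho t ^+ n).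
  have [q Wq] := splitW (x / rho t ^+ n).
  have [|r rE] := WQ (q := q * iota t ^+ n).
    have -> : j (q * iota t ^+ n) = x - rho (t ^+ n) * (x / rho t ^+ n - j q).
      rewrite rmorphM rmorphXn -/(rho t) [rho (t ^+ n)]rmorphXn mulrBr.
      by rewrite [_ * (x / _)]mulrC divfK //; ring.
    by apply: WB; [apply: VW | apply: WM].
  exists r; rewrite -[rho r]/(j (iota r)) -rE rmorphM rmorphXn -/(rho t).
  by rewrite mulrBl mulfK.
have [|l lP] := tdvd_complete dvrR (u := r).
  move=> n; have [|s sE] := WQ (q := iota (r n.+1 - r n) / iota t ^+ n).
    have -> : j (iota (r n.+1 - r n) / iota t ^+ n) =
      (x - rho (r n)) / rho t ^+ n
        - rho t * ((x - rho (r n.+1)) / rho t ^+ n.+1).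
      rewrite rmorphM fmorphV rmorphXn -/(rho t)
        -[j (iota (_ - _))]/(rho (_ - _)).
      by rewrite rmorphB exprS; field; rewrite tn0 t0.
    by apply: WB => //; apply: WM.
  exists s; apply/eqP; rewrite -(frac_eq fracQ) rmorphM rmorphXn -sE divfK //.
  by rewrite expf_neq0 // (frac_eq0 fracQ) (unif_neq0 dvrR).
exists (iota l) => n; have [s sE] := lP n.
have -> : (x - j (iota l)) / rho t ^+ n = (x - rho (r n)) / rho t ^+ n + rho s.
  have -> : j (iota l) = rho (r n) - rho s * rho t ^+ n.
    by rewrite -rmorphXn -rmorphM -sE rmorphB opprB addrC subrK.
  by field; apply: tn0.
by apply: WD => //; apply: VW.
Qed.

Let rel_total x : exists q, rel x q.
Proof.
have [n /rel_total_V[q qP]] := valr_denominator x.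
exists (q / iota t ^+ n) => m.
have -> : (x - j (q / iota t ^+ n)) / rho t ^+ m
    = (rho t ^+ n * x - j q) / rho t ^+ (n + m).
  rewrite rmorphM fmorphV rmorphXn -/(rho t) exprD.
  by field; rewrite !tn0.
exact: qP.
Qed.

Let rel_lin r x y q s : rel x q -> rel y s ->
  rel (rho r * x - y) (iota r * q - s).
Proof.
move=> xq ys n; have -> : (rho r * x - y - j (iota r * q - s)) / rho t ^+ n =
    rho r * ((x - j q) / rho t ^+ n) - (y - j s) / rho t ^+ n.
  by rewrite rmorphB rmorphM -/(rho r); ring.
exact: clW.
Qed.

Let rel_fraction q : rel (j q) q.
Proof. by move=> n; rewrite subrr mul0r. Qed.

Lemma retraction_of_maximal : exists g : F -> Q,
  [/\ forall x y, g (x + y) = g x + g y, forall q x, g (j q * x) = q * g x,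
      g 1 = 1 & forall x, V x -> exists r, g x = iota r].
Proof.
have /choice[g gP] := rel_total.
have gE x q : rel x q -> g x = q by apply: rel_fun.
have gB x y : g (x - y) = g x - g y.
  apply: gE; have := @rel_lin 1 x y _ _ (gP x) (gP y).
  by rewrite rmorph1 rmorph1 !mul1r.
have g0 : g 0 = 0 by rewrite -(subrr 0) gB subrr.
have gD x y : g (x + y) = g x + g y.
  have gN : g (- y) = - g y by rewrite -sub0r gB g0 sub0r.
  by rewrite -{1}[y]opprK gB gN opprK.
have gM r x : g (rho r * x) = iota r * g x.
  by rewrite -[rho r * x]subr0 -[RHS]subr0; apply: gE; apply: rel_lin => //;
    rewrite -g0.
exists g; split=> //.
- move=> q x; have [a [b [b0 ->]]] := frac_repr fracQ q.
  have b0' : iota b != 0 by rewrite (frac_eq0 fracQ).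
  have e : rho b * j (iota a / iota b) = rho a.
    by rewrite -[rho b]/(j (iota b)) -rmorphM [iota b * _]mulrC divfK.
  by apply: (mulfI b0'); rewrite -gM mulrA e gM mulrA [iota b * _]mulrC divfK.
- by apply: gE; rewrite -(rmorph1 j); apply: rel_fraction.
move=> x Vx; apply: WQ; have -> : j (g x) = x - (x - j (g x)) by ring.
by apply: WB; [apply: VW | have := gP x 0%N; rewrite divr1].
Qed.

End Retraction.

(** A maximal R-submodule of F that contains V and meets Q only in R does for
    all of V at once what the normalized traces do for its finite
    subextensions. *)
Lemma retraction_exists : exists g : F -> Q,
  [/\ forall x y, g (x + y) = g x + g y, forall q x, g (j q * x) = q * g x,
      g 1 = 1 & forall x, V x -> exists r, g x = iota r].
Proof.
have [||W [clW VW WZ maxW]] := @maximal_closed_avoiding R F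
    (fun r x y => rho r * x - y) V (fun x =>
      exists q, x = j q /\ ~ exists r, q = iota r).
- by move=> r x y Vx Vy; apply: (valrB valV) => //; apply: (valrM valV).
- by move=> x Vx [q [xq]]; apply; apply: valr_fraction; rewrite -xq.
have ZE (B : F -> Prop) :
    (forall x, B x -> ~ exists q, x = j q /\ ~ exists r, q = iota r) <->
    forall q, B (j q) -> exists r, q = iota r.
  split=> [BZ q Bq|BQ x Bx [q [xq qR]]].
    by apply: contrapT => qR; apply: (BZ _ Bq); exists q.
  by apply: qR; apply: BQ; rewrite -xq.
apply: (retraction_of_maximal (W := W)) => //.
  exact/ZE.
by move=> B clB WB /ZE; apply: maxW.
Qed.

End DvrExtension.

(** * Values of algebraic elements *)

Section SimpleSubfield.
Variables (Q F : fieldType) (j : {rmorphism Q -> F}) (u : F).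

Definition simple_ext (x : F) := exists p : {poly Q}, x = (map_poly j p).[u].

Lemma simple_ext_comp x p : simple_ext x -> simple_ext (map_poly j p).[x].
Proof. by case=> q ->; exists (p \Po q); rewrite map_comp_poly horner_comp. Qed.

Lemma simple_extC c : simple_ext (j c).
Proof. by exists c%:P; rewrite map_polyC hornerC. Qed.

Lemma simple_extM x y : simple_ext x -> simple_ext y -> simple_ext (x * y).
Proof. by case=> p -> [q ->]; exists (p * q); rewrite rmorphM hornerM. Qed.

(** The n+1 powers 1, x, ..., x ^ n, written as polynomials in u modulo M, lie
    in a space of dimension n. That the bound on the degree is the same for
    all x in Q[u] is what matters later. *)
Lemma simple_ext_annihilator (M : {poly Q}) n x : M != 0 -> size M = n.+1 ->
    (map_poly j M).[u] = 0 -> simple_ext x ->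
  exists P : {poly Q}, [/\ P != 0, (size P <= n.+1)%N & (map_poly j P).[x] = 0].
Proof.
move=> M0 szM Mu [p xp].
pose A := \matrix_(k < n.+1, i < n) (p ^+ k %% M)`_i.
have [v vA v0] : exists2 v : 'rV_n.+1, v *m A = 0 & v != 0.
  have : kermx A != 0.
    rewrite kermx_eq0 /row_free; apply: contraTneq (rank_leq_col A) => ->.
    by rewrite ltnn.
  case/rowV0Pn => v /sub_kermxP vA v0; by exists v.
exists (rVpoly v); split; first by apply: contraNneq v0 => v0;
  rewrite -[v]rVpolyK v0 linear0.
  exact: size_poly.
have e : rVpoly v = \sum_(k < n.+1) v 0 k *: 'X^k.
  rewrite [LHS](@poly_def _ n.+1 (fun k =>
    if insub k is Some i then v 0 i else 0)).
  by apply: eq_bigr => k _; rewrite valK.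
have vM : \sum_(k < n.+1) v 0 k *: (p ^+ k %% M) = 0.
  apply/polyP => i; rewrite coef_sum coef0.
  have [ni|i_n] := leqP n i.
    apply: big1 => k _; rewrite coefZ nth_default ?mulr0 //.
    by apply: leq_trans ni; have := ltn_modpN0 (p ^+ k) M0; rewrite szM.
  have := congr1 (fun B : 'rV_n => B 0 (Ordinal i_n)) vA; rewrite !mxE => e0;
    rewrite -[RHS]e0.
  by apply: eq_bigr => k _; rewrite coefZ mxE.
have evmod q : (map_poly j (q %% M)).[u] = (map_poly j q).[u].
  by rewrite {2}(divp_eq q M) rmorphD rmorphM hornerD hornerM Mu mulr0 add0r.
have := congr1 (fun q => (map_poly j q).[u]) vM.
rewrite /= rmorph0 horner0 => <-; rewrite e !rmorph_sum !horner_sum.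
apply: eq_bigr => k _ /=; rewrite !map_polyZ !hornerZ evmod map_polyXn hornerXn.
by rewrite rmorphXn horner_exp xp.
Qed.

End SimpleSubfield.

Lemma common_denominator (R : idomainType) (Q : fieldType)
    (iota : {rmorphism R -> Q}) (I : finType) (f : I -> Q) :
  fraction_field iota ->
  exists2 c : R, c != 0 & forall i, exists r, iota c * f i = iota r.
Proof.
move=> fracQ.
have /choice[b bP] i : exists b : R, b != 0 /\ exists a, iota b * f i = iota a.
  have [a [b [b0 ->]]] := frac_repr fracQ (f i); exists b; split=> //; exists a.
  by rewrite mulrC divfK // (frac_eq0 fracQ).
exists (\prod_i b i); first by apply/prodf_neq0 => i _; have [] := bP i.
move=> i; have [_ [a ba]] := bP i; exists (\prod_(k | k != i) b k * a).
by rewrite (bigD1 i) //= [b i * _]mulrC !rmorphM -mulrA ba.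
Qed.

Section ValuationPowers.
Variables (F : fieldType) (V : F -> Prop).
Hypothesis valV : valuation_ring V.

Lemma dominant_term (f : nat -> F) n : (exists2 i, (i < n)%N & f i != 0) ->
  exists i, [/\ (i < n)%N, f i != 0 & forall k, (k < n)%N -> V (f k / f i)].
Proof.
elim: n => [[] //|n IH] [i0 ltin fi0].
have [/IH[i [ltin' fi fmax]]|nex] := EM (exists2 i, (i < n)%N & f i != 0);
  last first.
  have z k : (k < n)%N -> f k = 0.
    move=> kn; apply: contrapT => /eqP fk; apply: nex; by exists k.
  have i0n : i0 = n.
    move: ltin; rewrite ltnS leq_eqVlt => /orP[/eqP //|/z e].
    by rewrite e eqxx in fi0.
  rewrite i0n in fi0; exists n; split=> // k; rewrite ltnS leq_eqVlt.
  case/orP => [/eqP ->|/z ->]; first by rewrite divff //; apply: (valr1 valV).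
  by rewrite mul0r; apply: (valr0 valV).
have [h|h] := valr_total valV (f n / f i).
  exists i; split=> // [|k]; first exact: ltnW.
  by rewrite ltnS leq_eqVlt => /orP[/eqP ->|/fmax].
have [fn0|fn0] := eqVneq (f n) 0.
  exists i; split=> // [|k]; first exact: ltnW.
  rewrite ltnS leq_eqVlt => /orP[/eqP ->|/fmax //].
  by rewrite fn0 mul0r; apply: (valr0 valV).
exists n; split=> // k; rewrite ltnS leq_eqVlt.
case/orP => [/eqP ->|/fmax fk]; first by rewrite divff //; apply: (valr1 valV).
have -> : f k / f n = (f k / f i) * (f n / f i)^-1 by field; rewrite fi fn0.
exact: (valrM valV).
Qed.

(** The largest value among the terms of a vanishing sum is taken twice:
    otherwise, after division by the dominant term, 1 would be a sum of
    elements of the maximal ideal. *)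
Lemma zero_sum_unit_ratio (f : nat -> F) n :
    (exists2 i, (i < n)%N & f i != 0) -> \sum_(i < n) f i = 0 ->
  exists a b, [/\ (a < b < n)%N, f a != 0, f b != 0,
                V (f a / f b) & V (f b / f a)].
Proof.
move=> /dominant_term[i [ltin fi fmax]] f0.
have [[k [kn ki [fk Vfk]]]|nex] := EM (exists k, [/\ (k < n)%N, k != i &
    f k != 0 /\ V (f k / f i)^-1]); last first.
  exfalso; have : valr_max V 1.
    have <- : - \sum_(k < n | k != Ordinal ltin) f k / f i = 1.
      move: f0; rewrite (bigD1 (Ordinal ltin)) //= => /eqP.
      rewrite addr_eq0 => /eqP e; rewrite -mulr_suml -[X in X / _]opprK -e.
      by rewrite mulNr opprK divff.
    rewrite -mulN1r; apply: (valr_maxMl valV).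
      by apply: (valrN valV); apply: (valr1 valV).
    apply: big_ind => [||k ki]; [by left | exact: (valr_maxD valV) |].
    have [->|fk] := eqVneq (f k) 0; first by left; rewrite mul0r.
    right=> h; apply: nex; exists k; split=> //.
  case=> [/eqP|]; first by rewrite oner_eq0.
  by apply; rewrite invr1; apply: (valr1 valV).
rewrite invf_div in Vfk; have [lt|lt|e] := ltngtP k i.
- by exists k, i; rewrite lt ltin; split=> //; apply: fmax.
- by exists i, k; rewrite lt kn; split=> //; apply: fmax.
- by rewrite e eqxx in ki.
Qed.

(** Two terms of the equation of y have the same value, so a power of y has
    the value of an element of Q. *)
Lemma algebraic_power_unit (Q : fieldType) (j : {rmorphism Q -> F})
    (P : {poly Q}) n y : P != 0 -> (size P <= n.+1)%N -> y != 0 ->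
    (map_poly j P).[y] = 0 ->
  exists e q w, [/\ (0 < e <= n)%N, q != 0, w != 0, V w /\ V w^-1
                  & y ^+ e = w * j q].
Proof.
move=> P0 szP y0 Py; pose f i := j P`_i * y ^+ i.
have f0 : \sum_(i < n.+1) f i = 0.
  rewrite -[RHS]Py (@horner_coef_wide _ n.+1) ?size_map_poly //.
  by apply: eq_bigr => i _; rewrite coef_map.
have [|a [b [/andP[ab bn] fa fb Vab Vba]]] := zero_sum_unit_ratio _ f0.
  exists (size P).-1.
    by rewrite prednK ?size_poly_gt0.
  by rewrite mulf_neq0 ?expf_neq0 // fmorph_eq0 -lead_coefE lead_coef_eq0.
have Pz k : f k != 0 -> P`_k != 0.
  by apply: contraNneq => e; rewrite /f e rmorph0 mul0r.
exists (b - a)%N, (P`_a / P`_b), (f b / f a); split.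
- by rewrite subn_gt0 ab leq_subLR (leq_trans _ (leq_addl _ _)).
- by rewrite mulf_neq0 ?invr_eq0 ?Pz.
- by rewrite mulf_neq0 ?invr_eq0.
- by rewrite invf_div.
have yb : y ^+ b = y ^+ (b - a) * y ^+ a by rewrite -exprD subnK ?(ltnW ab).
rewrite rmorphM fmorphV /f yb.
by field; rewrite !fmorph_eq0 !expf_neq0 ?Pz.
Qed.

End ValuationPowers.

(** * Stability of the valuation ring under the derivation *)

Section Preservation.
Variables (R : idomainType) (t : R) (Q F : fieldType).
Variables (iota : {rmorphism R -> Q}) (j : {rmorphism Q -> F}).
Hypotheses (dvrR : complete_dvr t) (fracQ : fraction_field iota).
Let rho : {rmorphism R -> F} := j \o iota.
Hypotheses (chQ : [pchar Q] =i pred0) (algF : forall x : F, algebraicOver j x).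
Variable V : F -> Prop.
Hypotheses (valV : valuation_ring V) (VR : forall r, V (rho r)).
Hypothesis VtV : ~ V (rho t)^-1.
Variables (d : R -> R) (D : F -> F).
Hypotheses (derd : derivation d) (derDF : derivation D).
Hypothesis Drho : forall r, D (rho r) = rho (d r).

Let rho0 r : (rho r == 0) = (r == 0). Proof. exact: rho_eq0. Qed.
Let t0 : rho t != 0. Proof. by rewrite rho0 (unif_neq0 dvrR). Qed.

Let max_t : valr_max V (rho t). Proof. by right. Qed.

Section Bounded.
Variable g : F -> Q.
Hypotheses (gD : forall x y, g (x + y) = g x + g y)
  (gM : forall q x, g (j q * x) = q * g x) (g1 : g 1 = 1)
  (gV : forall x, V x -> exists r, g x = iota r).

Let g_sum (I : Type) (r : seq I) (f : I -> F) :
  g (\sum_(a <- r) f a) = \sum_(a <- r) g (f a).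
Proof.
apply: (big_morph g gD); apply: (addIr (g 0)); by rewrite -gD !add0r.
Qed.

Let ev_coefs (p : {poly Q}) n x : (size p <= n)%N ->
  (map_poly j p).[x] = \sum_(a < n) j p`_a * x ^+ a.
Proof.
move=> szp; rewrite (@horner_coef_wide _ n) ?size_map_poly //.
by apply: eq_bigr => a _; rewrite coef_map.
Qed.

(* The powers 1, u, ..., u ^ (n-1) are a basis of Q[u], and G is the Gram
   matrix of the bilinear form g (x y) in that basis. *)
Section Gram.
Variables (u : F) (M : {poly Q}) (n : nat).
Hypotheses (M0 : M != 0) (szM : size M = n.+1) (Mu : (map_poly j M).[u] = 0).
Hypothesis Mmin : forall q, (map_poly j q).[u] = 0 -> M %| q.

Let G : 'M[Q]_n := \matrix_(a, b) g (u ^+ (a + b)).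

Let evmod q : (map_poly j (q %% M)).[u] = (map_poly j q).[u].
Proof.
by rewrite {2}(divp_eq q M) rmorphD rmorphM hornerD hornerM Mu mulr0 add0r.
Qed.

Let size_mod q : (size (q %% M)%R <= n)%N.
Proof. by have := ltn_modpN0 q M0; rewrite szM. Qed.

Let gramE (v : 'rV[Q]_n) b :
  (v *m G) 0 b = g ((map_poly j (rVpoly v)).[u] * u ^+ b).
Proof.
rewrite mxE (ev_coefs (n := n)) ?size_poly // mulr_suml g_sum.
by apply: eq_bigr => a _; rewrite mxE -mulrA -exprD gM coef_rVpoly_ord.
Qed.

(* The form is nondegenerate on the field Q[u]: if g (w y) = 0 for all y in
   Q[u], take for y a multiple of 1/w to get g (c) = 0 for some nonzero c in
   R, although g is the identity on R. *)
Let gram_unit : G \in unitmx.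
Proof.
rewrite -row_free_unit -kermx_eq0; apply/rowV0P => v /sub_kermxP vG.
set w := (map_poly j (rVpoly v)).[u].
have gw q : g (w * (map_poly j q).[u]) = 0.
  rewrite -evmod (ev_coefs (n := n)) // mulr_sumr g_sum big1 // => b _.
  by rewrite mulrCA gM -gramE vG mxE mulr0.
have [w0|w0] := eqVneq w 0; last first.
  have [c c0 [P cP]] := algebraic_annihilator fracQ algF w0.
  have [q qE] : simple_ext j u (map_poly rho P).[w].
    by rewrite map_poly_comp; apply: simple_ext_comp; exists (rVpoly v).
  have := gw q; rewrite -qE -cP => gc; have := gM (iota c) 1.
  rewrite mulr1 g1 mulr1 -[j (iota c)]/(rho c) gc => /esym/eqP.
  by rewrite (frac_eq0 fracQ) (negPf c0).
apply: (can_inj rVpolyK); rewrite linear0; apply/eqP; apply: contraT => v0.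
have := dvdp_leq v0 (Mmin w0); rewrite szM ltnNge => /negP[].
exact: size_poly.
Qed.

(** The coordinates of w are the values g (w u ^ b), which are in R,
    multiplied by the inverse Gram matrix, whose denominators do not depend on
    w. So the elements of V in Q[u] lie in a finitely generated R-module. *)
Lemma gram_bound : exists2 c : R, c != 0 & forall w, simple_ext j u w -> V w ->
  V u -> exists P : {poly R}, rho c * w = (map_poly rho P).[u].
Proof.
have [c c0 cP] := common_denominator (fun ab :
  'I_n * 'I_n => invmx G ab.1 ab.2) fracQ.
exists c => // _ [p ->] Vw Vu; set v := poly_rV (p %% M) : 'rV_n.
have vE : rVpoly v = p %% M by rewrite poly_rV_K.
have vG : v = (v *m G) *m invmx G by rewrite mulmxK.
have /choice[s sP] (a : 'I_n) : exists s, iota c * v 0 a = iota s.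
  rewrite vG mxE mulr_sumr.
  apply: (big_ind (fun x => exists s, x = iota s)).
  - by exists 0; rewrite rmorph0.
  - by move=> _ _ [x ->] [y ->]; exists (x + y); rewrite rmorphD.
  move=> b _; rewrite mulrCA gramE vE evmod.
  have [|r ->] := @gV ((map_poly j p).[u] * u ^+ b).
    by apply: (valrM valV) => //; apply: (valrX valV).
  by have [r' ->] := cP (b, a); exists (r * r'); rewrite rmorphM.
have sE a : (\row_a s a) 0 a = s a by rewrite mxE.
exists (rVpoly (\row_a s a)).
rewrite -evmod -vE (ev_coefs (n := n)) ?size_poly // mulr_sumr.
rewrite (@horner_coef_wide _ n); last first.
  by apply: leq_trans (size_poly _ _) _; apply: size_poly.
apply: eq_bigr => a _; rewrite coef_map !coef_rVpoly_ord sE mulrA.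
by congr (_ * _); rewrite -[RHS]/(j (iota (s a))) -sP rmorphM.
Qed.

End Gram.

(** By gram_bound the elements of V in Q[u] are combinations of powers of u
    with a common denominator, so their derivatives are bounded in terms of D
    u. *)
Lemma der_bounded u : V u ->
  exists N, forall w, simple_ext j u w -> V w -> V (rho t ^+ N * D w).
Proof.
move=> Vu; have [M [M0 szM Mu _ Mmin]] := minimal_annihilator chQ algF u.
have [c c0 cP] := @gram_bound u M (size M).-1 M0 (esym (prednK (ltnW szM))) Mu
  Mmin.
have [m Vm] := valr_denominator dvrR fracQ algF valV VR (D u).
have [n [e [ue ce]]] := unit_unif_decomp dvrR c0.
exists (m + n)%N => w Lw Vw; have [P cw] := cP w Lw Vw Vu.
have e0 : rho e != 0 by rewrite rho0; apply: contraTneq ue => ->;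
  rewrite unitr0.
have -> : rho t ^+ (m + n) * D w = rho e^-1 * (rho t ^+ m * (rho c * D w)).
  rewrite ce rmorphM rmorphXn exprD -(rho_unitV j fracQ ue).
  by apply: (mulfI e0); rewrite [RHS]mulrA mulfV // mul1r; ring.
apply: (valrM valV) => //.
have := congr1 D cw; rewrite (derM derDF) Drho
  (derivation_horner _ _ derd derDF Drho).
move=> /(canRL (addKr _)) ->; rewrite /total_derivative.
have VP (p : {poly R}) : V (map_poly rho p).[u].
  by apply: (valr_horner valV) => // k; rewrite coef_map; apply: VR.
have Vt : V (rho t ^+ m) by apply: (valrX valV).
rewrite !mulrDr; apply: (valrD valV).
  by apply: (valrM valV) => //; apply: (valrN valV); apply: (valrM valV).
apply: (valrD valV); first exact: (valrM valV).
by rewrite mulrCA; apply: (valrM valV).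
Qed.

End Bounded.

Section Logarithmic.
Hypothesis dt : d t = t.

Let log_R r : r != 0 -> exists s, d r = s * r.
Proof.
case/(unit_unif_decomp dvrR) => [[|n] [e [ue ->]]].
  by exists (d e / e); rewrite mulr1 divrK.
exists (d e / e + n.+1%:R).
rewrite (derM derd) (derX derd) dt mulrDl [d e / e * _]mulrA divrK //.
by rewrite [t ^+ n.+1]exprSr; ring.
Qed.

(** As d t = t, each r = e t ^ n in R with e a unit divides its derivative;
    for d/dt this fails at r = t. *)
Lemma log_deriv_fraction q : q != 0 -> V (D (j q) / j q).
Proof.
have [a [b [b0 ->]]] := frac_repr fracQ q => ab0.
have a0 : a != 0 by apply: contraNneq ab0 => ->; rewrite rmorph0 mul0r.
have [sa da] := log_R a0; have [sb db] := log_R b0.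
have ra0 : rho a != 0 by rewrite rho0.
have rb0 : rho b != 0 by rewrite rho0.
suff -> : D (j (iota a / iota b)) / j (iota a / iota b) =
  rho (sa - sb) by apply: VR.
rewrite rmorphM fmorphV -[j (iota a)]/(rho a) -[j (iota b)]/(rho b).
have : D (rho a) = D (rho a / rho b) * rho b + rho a / rho b * D (rho b).
  by rewrite -(derM derDF) divfK.
rewrite !Drho da db !rmorphM => e.
have -> : D (rho a / rho b) =
    (rho sa * rho a - rho a / rho b * (rho sb * rho b)) / rho b.
  by rewrite e addrK mulfK.
by rewrite rmorphB; field; rewrite ra0 rb0.
Qed.

Lemma log_deriv_power y w q e : y != 0 -> w != 0 -> q != 0 ->
    y ^+ e.+1 = w * j q ->
  D y = y * (e.+1%:R^-1 * (D w / w + D (j q) / j q)).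
Proof.
move=> y0 w0 q0 ye; have := congr1 D ye.
rewrite (derX derDF) (derM derDF) => E.
have e0 : e.+1%:R != 0 :> F.
  by rewrite -(rmorph_nat j) fmorph_eq0 ((pcharf0P Q).1 chQ).
have jq0 : j q != 0 by rewrite fmorph_eq0.
have -> : D w / w + D (j q) / j q = e.+1%:R * y ^+ e * D y / y ^+ e.+1.
  by rewrite E ye; field; rewrite w0 jq0.
rewrite exprS; move: e.+1%:R e0 {E} => c c0.
by field; rewrite c0 y0 expf_neq0.
Qed.

Section CoefficientField.
Variables (k : fieldType) (i : {rmorphism k -> R}) (K : subringClosed R).
Hypotheses (cfK : coefficient_field t i K) (dK : forall c, c \in K -> d c = 0).

(** Divide an equation of x over R by the largest power of t that divides it. *)
Lemma primitive_annihilator (x : F) : exists2 P : {poly R},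
  (map_poly rho P).[x] = 0 & exists n, ~ tdvd t 1 P`_n.
Proof.
have [p p0 /eqP px] := algF x.
have [c c0 [P cP]] := clear_denominators fracQ p.
have Px : (map_poly rho P).[x] = 0.
  by rewrite map_poly_comp -cP map_polyZ hornerZ px mulr0.
have P0 : P`_(size p).-1 != 0.
  rewrite -(frac_eq0 fracQ) -coef_map -cP coefZ -lead_coefE mulf_neq0 //.
    by rewrite (frac_eq0 fracQ).
  by rewrite lead_coef_eq0.
have [N [e [ue PE]]] := unit_unif_decomp dvrR P0.
move: {p p0 px c c0 cP P0} ((size p).-1) PE Px => m.
elim: N P => [|N IH] P Pm Px.
  exists P => //; exists m => /(tdvd1_nonunit dvrR); rewrite Pm mulr1.
  by rewrite ue.
have [[n Pn]|nex] := EM (exists n, ~ tdvd t 1 P`_n); first by exists P => //;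
  exists n.
have /choice[f fP] n : exists y, P`_n = y * t.
  have [y Py] : tdvd t 1 P`_n by apply: contrapT => Pn; apply: nex; exists n.
  by exists y.
have PE : P = (\poly_(n < size P) f n) * t%:P.
  apply/polyP => n; rewrite coefMC coef_poly; case: ltnP => // sn.
  by rewrite nth_default // mul0r.
apply: (IH (\poly_(n < size P) f n)).
  apply: (mulIf (unif_neq0 dvrR)); rewrite -coefMC -PE Pm exprSr; ring.
apply: (mulIf t0); rewrite mul0r -Px {2}PE rmorphM hornerM /= map_polyC hornerC.
by [].
Qed.

(** Replacing the coefficients of a primitive equation of x by their
    representatives in K gives a nonzero polynomial over K whose value at x is
    in the maximal ideal. For a polynomial of minimal degree with this
    property, the derivative is not 0 and has smaller degree, so its value at
    x is a unit. *)
Lemma separable_residue_relation x : V x -> exists p : {poly R},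
  [/\ p \is a polyOver K, valr_max V (map_poly rho p).[x],
      (map_poly rho p^`()).[x] != 0 & V (map_poly rho p^`()).[x]^-1].
Proof.
move=> Vx; pose ann (p : {poly R}) :=
  p \is a polyOver K /\ p != 0 /\ valr_max V (map_poly rho p).[x].
have Vev (p : {poly R}) : V (map_poly rho p).[x].
  by apply: (valr_horner valV) => // n; rewrite coef_map; apply: VR.
have [P Px [n Pn]] := primitive_annihilator x.
have /choice[c cP] m : exists c, c \in K /\ exists y, P`_m - c = y * t.
  by have [c Kc [y yE]] := coef_field_repr cfK P`_m; exists c; split=> //;
    exists y.
have /choice[y yP] m : exists y, P`_m - c m = y * t by have [] := cP m.
have [|p [Kp [p0 px]] pmin] := @ex_minimal_size R ann (\poly_(m < size P) c m).
  split; first by apply: polyOver_poly => m _; have [] := cP m.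
  split.
    apply/eqP => /polyP/(_ n); rewrite coef_poly coef0.
    case: ltnP => [_ cn0|sn _]; apply: Pn.
      by have := yP n; rewrite cn0 subr0 => ->; exists (y n).
    by rewrite nth_default //; exists 0; rewrite mul0r.
  have PE : P = \poly_(m < size P) c m + (\poly_(m < size P) y m) * t%:P.
    apply/polyP => m; rewrite coefD coefMC !coef_poly; case: ltnP => sm.
      by rewrite -yP addrC subrK.
    by rewrite nth_default // mul0r addr0.
  move: Px; rewrite PE rmorphD rmorphM hornerD hornerM /= map_polyC hornerC -PE.
  move=> /eqP; rewrite addr_eq0 => /eqP ->; rewrite -mulNr.
  by apply: (valr_maxMl valV) => //; apply: (valrN valV).
have szp : (1 < size p)%N.
  rewrite ltnNge; apply/negP => /size1_polyC pC.
  move: p0 px; rewrite pC map_polyC hornerC polyC_eq0 => p00.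
  have [up|/(coef_field_tdvd cfK (polyOverP Kp 0%N))/eqP] :=
    unit_or_tdvd dvrR p`_0; last first.
    by rewrite (negPf p00).
  apply: (valr_max_notin (V := V)); last by rewrite rho0.
  by rewrite (rho_unitV j fracQ up).
have nat0 m : m.+1%:R != 0 :> R.
  by rewrite -(frac_eq0 fracQ) rmorph_nat ((pcharf0P Q).1 chQ).
have dp0 : p^`() != 0 by exact: deriv_neq0.
exists p; have [||dpx Vdpx] := valr_max_unit (V := V)
  (x := (map_poly rho p^`()).[x]) => //.
move=> dpx; have [|] := leqP (size p) (size p^`()).
  by rewrite leqNgt lt_size_deriv.
by rewrite ltnNge pmin //; split; [apply: polyOver_deriv | split].
Qed.

(** Take p over K with y = p(x) in the maximal ideal and p'(x) a unit. Since d
    vanishes on K, D y = p'(x) D x. On the other hand a power of y is w q with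
    w a unit and q in Q, so D y / y is D w / w + D q / q up to an integer
    factor, and D q / q is in V. *)
Lemma der_step u x : V u -> simple_ext j u x -> V x ->
  exists y w a b, [/\ simple_ext j u y /\ valr_max V y,
    simple_ext j u w /\ V w, V a, V b & D x = y * (a * D w + b)].
Proof.
move=> Vu Lx Vx; have [p [Kp px dp0 Vdp]] := separable_residue_relation Vx.
set y := (map_poly rho p).[x] in px;
  set z := (map_poly rho p^`()).[x] in dp0 Vdp.
have Ly : simple_ext j u y.
  by rewrite /y map_poly_comp; apply: simple_ext_comp.
have Dy : D y = z * D x.
  rewrite /y (derivation_horner _ _ derd derDF Drho) /total_derivative.
  have -> : map_poly d p = 0.
    apply/polyP => n; rewrite coef_map_id0 ?(der0 derd) // coef0.
    exact/dK/(polyOverP Kp).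
  by rewrite rmorph0 horner0 add0r.
have DxE : D x = D y / z by rewrite Dy mulrC mulKf.
have [y0|y0] := eqVneq y 0.
  exists 0, 1, 0, 0; split; try (by apply: (valr0 valV)).
  - split; last by left.
    by rewrite -(rmorph0 j); apply: simple_extC.
  - split; last exact: (valr1 valV).
    by rewrite -(rmorph1 j); apply: simple_extC.
  by rewrite DxE y0 (der0 derDF) !mul0r.
have [P P0 /eqP Py] := algF y.
have [[|e] [q [w [/andP[e0 _] q0 w0 [Vw VwV] ye]]]] :=
  algebraic_power_unit valV P0 (leqSpred (size P)) y0 Py => //.
exists y, w, (z^-1 * e.+1%:R^-1 / w), (z^-1 * e.+1%:R^-1 * (D (j q) / j q)).
have Ve : V e.+1%:R^-1.
  have ue : (e.+1)%:R \is a @GRing.unit R.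
    have [//|/(coef_field_tdvd cfK)] := unit_or_tdvd dvrR e.+1%:R.
    move=> /(_ (rpred_nat _ _))/eqP; rewrite -(frac_eq0 fracQ) rmorph_nat.
    by rewrite ((pcharf0P Q).1 chQ).
  by rewrite -(rmorph_nat rho) (rho_unitV j fracQ ue).
split=> //.
- split=> //; have -> : w = y ^+ e.+1 * j q^-1.
    by rewrite ye fmorphV mulfK // fmorph_eq0.
  apply: simple_extM; last exact: simple_extC.
  have -> : y ^+ e.+1 = (map_poly j 'X^(e.+1)).[y].
    by rewrite map_polyXn hornerXn.
  exact: simple_ext_comp.
- by do 2! apply: (valrM valV) => //.
- by apply: (valrM valV); [apply: (valrM valV) | apply: log_deriv_fraction].
by rewrite DxE (log_deriv_power y0 w0 q0 ye); ring.
Qed.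

End CoefficientField.

(** The exponents e of algebraic_power_unit are at most the degree n of u, so
    E = n! is a multiple of all of them: a nonunit in Q[u] has value at least
    1/E times that of t. *)
Lemma max_power_divisible u : exists2 E, (0 < E)%N &
  forall y, simple_ext j u y -> valr_max V y -> V (y ^+ E / rho t).
Proof.
have [M [M0 szM Mu _ _]] := minimal_annihilator chQ algF u.
have szM' : size M = (size M).-1.+1 by rewrite prednK // ltnW.
set n := (size M).-1 in szM'.
exists n`!; first exact: fact_gt0.
move=> y Ly my; have [->|y0] := eqVneq y 0.
  by rewrite expr0n eqn0Ngt fact_gt0 mul0r; apply: (valr0 valV).
have [P [P0 szP Py]] := simple_ext_annihilator M0 szM' Mu Ly.
have [e [q [w [/andP[e0 en] q0 w0 [Vw VwV] ye]]]] :=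
  algebraic_power_unit valV P0 szP y0 Py.
have mye : valr_max V (y ^+ e).
  case: e e0 {en ye} => // e _; rewrite exprSr; apply: (valr_maxMl valV) => //.
  by apply: (valrX valV); apply: (valr_maxW valV).
have jqE : j q = w^-1 * y ^+ e by rewrite ye mulKf.
have mq : valr_max V (j q) by rewrite jqE; apply: (valr_maxMl valV).
have [r qr] := valr_fraction dvrR fracQ valV VR VtV (valr_maxW valV mq).
have [ur|[s rs]] := unit_or_tdvd dvrR r.
  case: (valr_max_notin (V := V) (x := j q)) => //.
    by rewrite qr -[j (iota r)]/(rho r) (rho_unitV j fracQ ur).
  by rewrite fmorph_eq0.
have [[|m] mE] : exists m, n`! = (e * m)%N.
- by have /dvdnP[m ->] := dvdn_fact (introT andP (conj e0 en)); exists m;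
    rewrite mulnC.
- by move: (fact_gt0 n); rewrite mE muln0.
have yt : y ^+ e / rho t = w * rho s.
  rewrite ye qr -[j (iota r)]/(rho r) rs expr1 rmorphM.
  by rewrite mulrA mulfK.
rewrite mE exprM exprSr -mulrA yt; apply: (valrM valV);
  last exact: (valrM valV).
by do 2! apply: (valrX valV); apply: (valr_maxW valV).
Qed.

(** In terms of a valuation v with v(t) = 1: suppose v(D x) >= -r/E for all x
    of V in Q[u]. By der_step, D x = y (a D w + b) with w again in V and Q[u]
    and v(y) >= 1/E, so the bound improves to -(r-1)/E. By der_bounded the
    descent can start, and it ends with v(D x) >= 0. *)
Lemma valuation_ring_der_stable (k : fieldType) (i : {rmorphism k -> R})
    (K : subringClosed R) :
  coefficient_field t i K -> (forall c, c \in K -> d c = 0) ->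
  forall u, V u -> V (D u).
Proof.
move=> cfK dK u Vu.
have [g [gD gM g1 gV]] := retraction_exists dvrR fracQ algF valV VR VtV.
have [N NP] := der_bounded gD gM g1 gV Vu.
have [E E0 EP] := max_power_divisible u.
(* If z is not in V, factor it out of a z + b. *)
have affine r a b z : V a -> V b -> V (rho t ^+ r * z ^+ E) ->
    V (rho t ^+ r * (a * z + b) ^+ E).
  move=> Va Vb Vz; have Vt : V (rho t ^+ r) by apply: (valrX valV).
  have [h|h] := valr_total valV z.
    apply: (valrM valV) => //; apply: (valrX valV); apply: (valrD valV) => //.
    exact: (valrM valV).
  have [z0|z0] := eqVneq z 0.
    by rewrite z0 mulr0 add0r; apply: (valrM valV) => //; apply: (valrX valV).
  have -> : a * z + b = z * (a + b / z) by field.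
  rewrite exprMn mulrA; apply: (valrM valV) => //; apply: (valrX valV).
  by apply: (valrD valV) => //; apply: (valrM valV).
have descent r : (forall x, simple_ext j u x -> V x ->
    V (rho t ^+ r * D x ^+ E)) ->
  forall x, simple_ext j u x -> V x -> V (D x ^+ E).
  elim: r => [|r IH] rP; first by move=> x Lx Vx; have := rP x Lx Vx;
    rewrite mul1r.
  apply: IH => x Lx Vx.
  have [y [w [a [b [[Ly my] [Lw Vw] Va Vb ->]]]]] := der_step cfK dK Vu Lx Vx.
  have -> : rho t ^+ r * (y * (a * D w + b)) ^+ E =
      (y ^+ E / rho t) * (rho t ^+ r.+1 * (a * D w + b) ^+ E).
    by rewrite exprMn exprS; field.
  by apply: (valrM valV); [apply: EP | apply: affine => //; apply: rP].
apply: (@valr_root _ V valV _ E.-1); rewrite prednK //.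
apply: (descent (N * E)%N) => //; last first.
  by exists 'X; rewrite map_polyX hornerX.
by move=> x Lx Vx; rewrite exprM -exprMn; apply: (valrX valV); apply: NP.
Qed.

End Logarithmic.

End Preservation.

(** * The nonzero form on the differentials *)

(** The differentials are generated by the symbols db. *)
Lemma linear_kaehler_span (k B : comNzRingType) (phi : {rmorphism k -> B})
    (N : lmodType B) (h : {linear kaehler phi -> N}) (S : N -> Prop) :
    S 0 -> (forall x y, S x -> S y -> S (x + y)) ->
    (forall a b, S (a *: h (kaehler_d phi b))) ->
  forall w, S (h w).
Proof.
move=> S0 SD Sd w; rewrite -[w]kaehler_piK -[repr w]freeg_sumE !raddf_sum /=.
apply: (big_ind S) => // b _.
suff -> : h (kaehler_pi phi << coeff b (repr w) *g b >>) =
    coeff b (repr w) *: h (kaehler_d phi b) by [].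
by rewrite -linearZ /=; congr (h _); rewrite -linearZ freegZ mulr1.
Qed.

Theorem theorem3p1 (k : fieldType) (R : idomainType) (m : {pred R})
    (i : {rmorphism k -> R}) (F : fieldType)
    (j : {rmorphism {fraction R} -> F}) :
  [pchar k] =i pred0 ->
  is_dvr m ->
  adically_complete m ->
  (forall x : F, algebraicOver j x) ->
  let RtoF : {rmorphism R -> F} := j \o @FracField.tofrac R in
  let RtoB : {rmorphism R -> intClosure RtoF} := @toIntClosure R F RtoF in
  let OmegaB := kaehler (RtoB \o i) in
  exists f : {linear restrict_scalars RtoB OmegaB -> R^o},
  exists w : OmegaB, f w != 0.
Proof.
move=> chk dvrm complm algF rho RtoB OmegaB.
pose iota : {rmorphism R -> {fraction R}} := @FracField.tofrac R.
have fracQ : fraction_field iota := fraction_fieldP R.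
have [t dvrR] := complete_dvr_of_ideals dvrm complm.
have [K cfK] := coefficient_field_exists i dvrR chk.
have [d [derd dK dt]] := log_derivation_exists dvrR cfK.
have chQ : [pchar {fraction R}] =i pred0.
  apply/pcharf0P => -[|n]; first exact: eqxx.
  rewrite -(rmorph_nat iota) (frac_eq0 fracQ); apply/negbTE.
  by apply: contraTneq (natr_unit i chk n) => ->; rewrite unitr0.
have [dQ [derdQ dQiota]] := fraction_derivation fracQ derd.
have [D [derDF Dj]] := algebraic_derivation derdQ chQ algF.
have Drho r : D (rho r) = rho (d r) by rewrite [LHS]Dj dQiota.
have rhoV r : rho r = 0 -> r = 0.
  by move=> /eqP; rewrite [_ == 0](rho_eq0 j fracQ) => /eqP.
(* A valuation ring of F over R that does not contain 1/t; it contains B. *)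
have [||||V [valV VR VtV]] :=
  @valuation_ring_exists F (rho t) (fun x => exists r, x = rho r).
- move=> [] _ _ [a ->] [b ->].
    by exists (a * b); apply/esym/rmorphM.
  by exists (a - b); apply/esym/rmorphB.
- by exists 1; rewrite rmorph1.
- by exists t.
- case=> r tr; move/negP: (unif_nonunit dvrR); apply; apply/unitrPr; exists r.
  apply/eqP; rewrite -subr_eq0; apply/eqP/rhoV.
  rewrite rmorphB rmorphM rmorph1 -tr mulfV ?subrr //.
  by rewrite [_ == 0](rho_eq0 j fracQ) (unif_neq0 dvrR).
have {}VR r : V (rho r) by apply: VR; exists r.
have VD x : V x -> V (D x).
  exact: (valuation_ring_der_stable dvrR fracQ chQ algF valV VR VtV derd derDF
    Drho dt cfK dK).
have [g [gD gM g1 gV]] := retraction_exists dvrR fracQ algF valV VR VtV.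
pose B := intClosure rho.
pose valB : {rmorphism B -> F} := \val.
have VB (b : B) : V (valB b).
  by apply: (valr_int valV VR); apply/asboolP; case: b.
(* F as a B-module; the derivation D restricted to B induces the B-linear map
   h from the differentials to F, with image in V, and the form is g composed
   with h. *)
pose N := restrict_scalars valB F^o.
have [|h hd _] := @kaehler_universal k B (RtoB \o i) N (fun b => D (valB b)).
  split=> [a b|a b|c].
  - by rewrite rmorphD (derD derDF).
  - by rewrite rmorphM (derM derDF) addrC [D _ * _]mulrC.
  - rewrite -[valB _]/(rho (i c)) Drho dK ?rmorph0 //.
    exact: coef_field_img cfK c.
have Vh w : V (h w).
  apply: (@linear_kaehler_span k B (RtoB \o i) N h V) => [|x y|a b].
  - exact: (valr0 valV).
  - exact: (valrD valV).
  by rewrite hd; apply: (valrM valV) => //; apply: VD.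
have /choice[f fP] (w : OmegaB) : exists r, g (h w) = iota r by apply: gV.
have f_lin : linear (f : restrict_scalars RtoB OmegaB -> R^o).
  move=> r v w; apply/eqP; rewrite -(frac_eq fracQ) -fP; apply/eqP.
  rewrite [X in g X](_ : _ = j (iota r) * h v + h w); last first.
    by rewrite -[_ *: v]/(RtoB r *: (v : OmegaB)) linearP.
  by rewrite gD gM !fP rmorphD rmorphM.
pose fL : {linear restrict_scalars RtoB OmegaB -> R^o} :=
  HB.pack f (GRing.isLinear.Build R (restrict_scalars RtoB OmegaB) R^o *:%R f
    f_lin).
(* The form takes dt to g (D t) = g (t) = t. *)
exists fL, (kaehler_d (RtoB \o i) (RtoB t)).
rewrite -(frac_eq0 fracQ) /= -fP hd -[valB _]/(rho t) Drho dt.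
rewrite -[rho t]mulr1 -[rho t]/(j (iota t)) gM g1 mulr1 (frac_eq0 fracQ).
exact: unif_neq0 dvrR.
Qed.
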